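(* Let $(\Omega,T,\mu)$ be a topologically mixing piecewise expanding Markov system with Markov partition $\mathcal{J}=\{J_1,\dots,J_p\}$, let $I\subset\Omega$, $\varphi=\mathbf{1}_I$ satisfying condition (NA), $\alpha$ an irrational number, and $S:M\to M$, $M=\Omega\times\mathbb{T}$, $S(\omega,t)=(T\omega,t+\alpha\varphi(\omega))$, with invariant measure $\nu=\mu\times\mathrm{Leb}$ (all as specified in the context). Assume that all the branches of $T$ are full, i.e. $T(J_i)=\Omega$ for all $i$, that $\mu$ is a Bernoulli measure, i.e. $\mu([a_1\ldots a_n])=\mu([a_1])\cdots\mu([a_n])$ for all cylinders, and that $I$ depends only on the first symbol, i.e. $I$ is a union of $1$-cylinders. If $\gamma(\alpha)>d_\mu+1$, then $$\liminf_{n\to\infty}\frac{\log\mathbb{M}_{S,n}(x,y)}{-\log n}=\frac{1}{\gamma(\alpha)}<\frac{2}{C_\nu}\qquad\text{for }\nu\times\nu\text{-a.e. }(x,y).$$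
   Context: Setting. $\Omega$ is a finite-dimensional Riemannian manifold with distance $d$ and $T:\Omega\to\Omega$ is a piecewise expanding Markov map: there is $\beta>1$ with $\|D_xT^{-1}\|\le\beta^{-1}$ for every $x\in\Omega$, and there is a finite collection (Markov partition) $\mathcal{J}=\{J_1,\dots,J_p\}$ of closed proper sets such that (M1) $T$ is a $C^{1+\eta}$ diffeomorphism from $\mathrm{int}\,J_i$ onto its image; (M2) $\Omega=\bigcup_iJ_i$ and $\mathrm{int}\,J_i\cap\mathrm{int}\,J_j=\emptyset$ unless $i=j$; (M3) $T(J_i)\supset J_j$ whenever $T(\mathrm{int}\,J_i)\cap\mathrm{int}\,J_j\ne\emptyset$. Such a $T$ is semi-conjugated to a subshift of finite type. $T$ is topologically mixing, equivalently for each $i$ there is $n_i$ with $T^{n_i}J_i=\Omega$. The $T$-invariant probability measure $\mu$ is the equilibrium state of a potential $\psi:\Omega\to\mathbb{R}$ which is Hölder continuous on each $\mathrm{int}\,J_i$. Cylinders of size $q$ ($q$-cylinders) are the sets $[i_0\ldots i_{q-1}]=J_{i_0,\dots,i_{q-1}}=\bigcap_{n=0}^{q-1}T^{-n}J_{i_n}$. In this setting the correlation dimension $C_\mu$ exists. Skew product. $\mathbb{T}=\mathbb{R}/\mathbb{Z}$. $M=\Omega\times\mathbb{T}$ carries the sup distance $\max(d(\omega,\tilde\omega),\|t-s\|)$, where $\|\cdot\|$ is the distance to the nearest integer. Standing assumption (NA): for any $u\in[-\pi,\pi]$, the equation $fe^{iu\varphi}=\lambda f\circ T$, where $f$ is Hölder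 (on the subshift) and $\lambda\in S^1$, has only the trivial solutions $\lambda=1$ and $f$ constant. Irrationality exponent: $\gamma(\alpha)=\inf\{\beta:\liminf_{q\to\infty}q^{\beta}\|q\alpha\|>0\}\in[1,\infty]$ (with $1/\infty=0$). Dimensions: $d_\mu$ is the pointwise dimension of $\mu$, i.e. the $\mu$-a.e. constant value of $\lim_{r\to0}\frac{\log\mu(B(\omega,r))}{\log r}$. For a Borel probability measure $m$ on a metric space, the correlation dimension is $C_m=\lim_{r\to0}\frac{\log\int m(B(x,r))\,dm(x)}{\log r}$ when the limit exists. One has $C_\nu=C_\mu+1$. Shortest distance: $\mathbb{M}_{S,n}(x,y)=\min_{0\le i,j\le n-1}d_M(S^i(x),S^j(y))$, $d_M$ being the sup distance on $M$ (convention $\log0=-\infty$).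
   Formalization: I is taken as a union of a non-empty family of 1-cylinders, the Bernoulli weights μ(J_i) are required to be positive with sum 1 (so μ does not charge overlaps of the J_i), and the semi-conjugacy with the subshift is given as a Hölder coding map. *)

(* Defs.v *)
From HB Require Import structures.
From mathcomp Require Import all_boot all_order all_algebra.
From mathcomp Require Import all_classical all_reals all_analysis.
From mathcomp Require Import complex.

Set Implicit Arguments.
Unset Strict Implicit.
Unset Printing Implicit Defensive.

Import Order.TTheory GRing.Theory Num.Theory.
Import numFieldNormedType.Exports.

Local Open Scope classical_set_scope.
Local Open Scope ring_scope.

(* The base point is only there because the library builds generated
   sigma-algebras on pointed types; no definition below uses it. *)
#[short(type="pmetricType")]
HB.structure Definition PointedMetric (K : numDomainType) :=
  {M of Metric K M & isPointed M}.

Definition borel (R : realType) (Om : pmetricType R) :=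
  g_sigma_algebraType (@open Om).

Section Smoothness.
Context (R : realType) (n : nat).

Fixpoint Ck (k : nat) (U : set 'rV[R]_n) (f : 'rV[R]_n -> R) : Prop :=
  if k is k'.+1 then
    (forall z, U z -> differentiable f z) /\
    (forall i : 'I_n, Ck k' U (fun z => 'D_(delta_mx 0 i) f z))
  else forall z, U z -> {for z, continuous f}.

Definition smooth_on (U : set 'rV[R]_n) (f : 'rV[R]_n -> R) :=
  forall k, Ck k U f.

(* F is differentiable near z, and its differential is eta-Hoelder near z. *)
Definition C1holder_at (eta : R) (F : 'rV[R]_n -> 'rV[R]_n) (z : 'rV[R]_n) :=
  exists C : R, \forall z1 \near z & z2 \near z,
    differentiable F z1 /\
    forall v : 'rV[R]_n,
      `|'d F z1 v - 'd F z2 v| <= C * `|z1 - z2| `^ eta * `|v|.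

End Smoothness.

(* A piecewise C^1 path is a finite concatenation of C^1 arcs.  An arc is the
   restriction to [0, 1] of a map R -> Om that is C^1 at each point of [0, 1];
   it comes with its speed s.  Tangent vectors are row vectors in a chart. *)
Section Lengths.
Context (R : realType) (n : nat) (Om : metricType R) (A : Type).
Context (dom : A -> set Om) (chart : A -> Om -> 'rV[R]_n).
Context (gram : A -> Om -> 'M[R]_n).

Definition riem_qf (a : A) (x : Om) (v : 'rV[R]_n) : R :=
  (v *m gram a x *m v^T) 0 0.

Definition riem_norm (a : A) (x : Om) (v : 'rV[R]_n) : R :=
  Num.sqrt (riem_qf a x v).

Definition C1_curve_at (c : R -> Om) (t : R) :=
  {for t, continuous c} /\
  forall a, dom a (c t) ->
    (\forall u \near t, derivable (chart a \o c) u 1) /\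
    {for t, continuous (derive1 (chart a \o c))}.

Definition arc_length (x y : Om) (L : \bar R) :=
  exists (c : R -> Om) (s : R -> R),
    [/\ c 0 = x, c 1 = y,
        forall t, 0 <= t <= 1 ->
          C1_curve_at c t /\
          forall a, dom a (c t) ->
            s t = riem_norm a (c t) (derive1 (chart a \o c) t)
      & L = (\int[lebesgue_measure]_(t in `[0%R, 1%R]) (s t)%:E)%E].

Inductive path_length : Om -> Om -> \bar R -> Prop :=
| path_length_nil x : path_length x x 0%E
| path_length_cons x y z L1 L2 :
    arc_length x y L1 -> path_length y z L2 -> path_length x z (L1 + L2)%E.

End Lengths.

(* [rm_chart_inv a] is relevant on the image of [rm_dom a] only, and
   [rm_gram a x] is the Gram matrix of the metric tensor at x in the chart a.
   The last field makes the metric of Om the Riemannian distance; as it is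
   finite, Om is connected. *)
Record riemannian_manifold (R : realType) (n : nat) (Om : metricType R) := {
  rm_atlas : Type ;
  rm_dom : rm_atlas -> set Om ;
  rm_chart : rm_atlas -> Om -> 'rV[R]_n ;
  rm_chart_inv : rm_atlas -> 'rV[R]_n -> Om ;
  rm_gram : rm_atlas -> Om -> 'M[R]_n ;
  rm_cover : forall x, exists a, rm_dom a x ;
  rm_dom_open : forall a, open (rm_dom a) ;
  rm_image_open : forall a, open (rm_chart a @` rm_dom a) ;
  rm_chartK : forall a x, rm_dom a x -> rm_chart_inv a (rm_chart a x) = x ;
  rm_chart_cont : forall a x, rm_dom a x -> {for x, continuous (rm_chart a)} ;
  rm_chart_inv_cont : forall a z, (rm_chart a @` rm_dom a) z ->
    {for z, continuous (rm_chart_inv a)} ;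
  rm_transition_smooth : forall a b (j : 'I_n),
    smooth_on (rm_chart a @` (rm_dom a `&` rm_dom b))
      (fun z => rm_chart b (rm_chart_inv a z) 0 j) ;
  rm_gram_sym : forall a x, rm_dom a x -> (rm_gram a x)^T = rm_gram a x ;
  rm_gram_pos : forall a x (v : 'rV[R]_n), rm_dom a x -> v != 0 ->
    0 < riem_qf rm_gram a x v ;
  rm_gram_smooth : forall a (i j : 'I_n),
    smooth_on (rm_chart a @` rm_dom a)
      (fun z => rm_gram a (rm_chart_inv a z) i j) ;
  rm_gram_transition : forall a b x (v : 'rV[R]_n), rm_dom a x -> rm_dom b x ->
    riem_qf rm_gram a x v =
    riem_qf rm_gram b x ('d (rm_chart b \o rm_chart_inv a) (rm_chart a x) v) ;
  rm_dist : forall x y : Om,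
    (mdist x y)%:E = ereal_inf [set L | path_length rm_dom rm_chart rm_gram x y L]
}.

Section MapsOfManifolds.
Context (R : realType) (n : nat) (Om : metricType R).
Context (M : riemannian_manifold n Om).

Definition in_charts (a b : rm_atlas M) (F : Om -> Om) :
    'rV[R]_n -> 'rV[R]_n :=
  rm_chart b \o F \o rm_chart_inv a.

Definition tangent_norm (a : rm_atlas M) (x : Om) (v : 'rV[R]_n) : R :=
  riem_norm (@rm_gram _ _ _ M) a x v.

Definition C1holder_on (eta : R) (U : set Om) (F : Om -> Om) :=
  forall x, U x -> {for x, continuous F} /\
    forall a b, rm_dom a x -> rm_dom b (F x) ->
      C1holder_at eta (in_charts a b F) (rm_chart a x).

Definition C1holder_diffeo (eta : R) (U : set Om) (F : Om -> Om) :=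
  [/\ open (F @` U), C1holder_on eta U F
    & exists G : Om -> Om,
        (forall x, U x -> G (F x) = x) /\ C1holder_on eta (F @` U) G].

(* The norm of the inverse of D_x F is at most beta^-1. *)
Definition expanding_at (beta : R) (F : Om -> Om) (x : Om) :=
  forall a b, rm_dom a x -> rm_dom b (F x) -> forall v : 'rV[R]_n,
    tangent_norm a x v <=
    beta^-1 * tangent_norm b (F x) ('d (in_charts a b F) (rm_chart a x) v).

(* T is differentiated in the interiors of the J_i only, since it need not be
   continuous across their boundaries. *)
Record piecewise_expanding_markov (p : nat) (J : 'I_p -> set Om)
    (T : Om -> Om) (beta eta : R) : Prop := {
  pem_beta : 1 < beta ;
  pem_eta : 0 < eta <= 1 ;
  pem_closed : forall i, closed (J i) ;
  pem_proper : forall i, J i <> setT ;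
  pem_expanding : forall i x, (J i)° x -> expanding_at beta T x ;
  pem_diffeo : forall i, C1holder_diffeo eta (J i)° T ;
  pem_cover : \bigcup_i J i = setT ;
  pem_disjoint : forall i j, i <> j -> (J i)° `&` (J j)° = set0 ;
  pem_markov : forall i j,
    T @` (J i)° `&` (J j)° !=set0 -> J j `<=` T @` J i
}.

End MapsOfManifolds.

Definition topologically_mixing (X : topologicalType) (T : X -> X) :=
  forall U V : set X, open U -> open V -> U !=set0 -> V !=set0 ->
    exists N, forall k, (N <= k)%N -> (iter k T @` U) `&` V !=set0.

Section Coding.
Context (R : realType) (Om : metricType R) (p : nat).
Context (J : 'I_p -> set Om) (T : Om -> Om).

Definition shift_seq (x : nat -> 'I_p) : nat -> 'I_p := fun k => x k.+1.

Definition subshift : set (nat -> 'I_p) :=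
  [set x | forall k, T @` (J (x k))° `&` (J (x k.+1))° !=set0].

(* dist is the distance of the target; the subshift has the usual metrics
   theta ^ min {k | x k <> y k}. *)
Definition holder_on_subshift (Y : Type) (dist : Y -> Y -> R)
    (f : (nat -> 'I_p) -> Y) :=
  exists C theta : R, 0 < theta < 1 /\
    forall x y k, subshift x -> subshift y ->
      (forall j, (j < k)%N -> x j = y j) ->
      dist (f x) (f y) <= C * theta ^+ k.

(* Semi-conjugacy of the subshift with T.  T may be discontinuous at the
   boundary of J_i, so the intertwining relation is required only at interior
   points of the elements of the partition. *)
Record semi_conjugacy (pi : (nat -> 'I_p) -> Om) : Prop := {
  sc_holder : holder_on_subshift mdist pi ;
  sc_onto : pi @` subshift = setT ;
  sc_mem : forall x, subshift x -> J (x 0%N) (pi x) ;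
  sc_conj : forall x, subshift x -> (J (x 0%N))° (pi x) ->
    T (pi x) = pi (shift_seq x)
}.

Definition cylinder (q : nat) (a : 'I_q -> 'I_p) : set Om :=
  [set w | forall k : 'I_q, J (a k) (iter k T w)].

(* The solution f = 0, which solves the equation for every lambda, is
   disregarded. *)
Definition cond_NA (pi : (nat -> 'I_p) -> Om) (phi : Om -> R) :=
  forall u : R, - trigo.pi <= u <= trigo.pi ->
  forall (f : (nat -> 'I_p) -> R[i]) (lambda : R[i]),
    holder_on_subshift (fun z w => ComplexField.Normc.normc (z - w)) f ->
    ComplexField.Normc.normc lambda = 1 ->
    (exists2 x, subshift x & f x != 0) ->
    (forall x, subshift x ->
      f x * Complex (cos (u * phi (pi x))) (sin (u * phi (pi x))) =
      lambda * f (shift_seq x)) ->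
    lambda = 1 /\ exists c, forall x, subshift x -> f x = c.

End Coding.

Section Measures.
Context (d : measure_display) (X : measurableType d) (R : realType).
Implicit Types (m : probability X R) (T : X -> X).

Definition invariant_measure m T :=
  measurable_fun setT T /\ forall A, measurable A -> m (T @^-1` A) = m A.

(* Entropy of the n-th refinement of the partition into the fibres of xi;
   ln 0 = 0, so that null atoms do not contribute. *)
Definition block_entropy m T (k : nat) (xi : X -> 'I_k) (n : nat) : R :=
  \sum_(s : n.-tuple 'I_k)
    let q := fine (m [set w | forall j : 'I_n, xi (iter j T w) = tnth s j]) in
    - (q * ln q).

Definition ks_entropy m T : \bar R :=
  ereal_sup [set h | exists (k : nat) (xi : X -> 'I_k),
    (forall i, measurable (xi @^-1` [set i])) /\
    h = limn (fun n => (block_entropy m T xi n / n%:R)%:E)].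

Definition equilibrium_state m T (psi : X -> R) :=
  [/\ invariant_measure m T,
      m.-integrable setT (EFin \o psi)
    & forall m' : probability X R,
        invariant_measure m' T -> m'.-integrable setT (EFin \o psi) ->
        (ks_entropy m' T + \int[m']_x (psi x)%:E <=
         ks_entropy m T + \int[m]_x (psi x)%:E)%E].

End Measures.

Definition piecewise_holder (R : realType) (Om : metricType R) (p : nat)
    (J : 'I_p -> set Om) (psi : Om -> R) :=
  forall i, exists C kappa : R, 0 < kappa /\
    forall x y, (J i)° x -> (J i)° y ->
      `|psi x - psi y| <= C * mdist x y `^ kappa.

(* The weights mu [a] of a Bernoulli measure form a probability vector with
   positive entries.  This excludes measures carried by the boundaries of the
   J_i, where a piecewise Hoelder potential is not controlled.  As the J_i are closed and overlap along their boundaries,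
   the weights add up to 1 exactly when the overlaps are null, that is, when
   the J_i form a partition modulo mu. *)
Definition bernoulli_measure (R : realType) (Om : pmetricType R) (p : nat)
    (J : 'I_p -> set Om) (T : Om -> Om) (mu : probability (borel Om) R) :=
  [/\ forall i, 0 < fine (mu (J i)),
      \sum_(i < p) fine (mu (J i)) = 1
    & forall (q : nat) (a : 'I_q -> 'I_p),
        fine (mu (cylinder J T a)) = \prod_(k < q) fine (mu (J (a k)))].

Definition pointwise_dimension (R : realType) (Om : pmetricType R)
    (mu : probability (borel Om) R) (delta : R) :=
  {ae mu, forall w,
    ln (fine (mu [set v | mdist w v < r])) / ln r @[r --> 0^'+] --> delta}.

Definition correlation_dimension (d : measure_display) (X : measurableType d)
    (R : realType) (dist : X -> X -> R) (m : set X -> \bar R) (C : R) :=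
  ln (fine (\int[m]_x m [set y | (dist x y < r)%R])%E) / ln r @[r --> 0^'+] --> C.

(* The circle R/Z is represented by [0, 1), inside R. *)
Section Circle.
Context (R : realType).

Definition frac (t : R) : R := t - (Num.floor t)%:~R.

Definition dist_int (t : R) : R := Num.min (frac t) (1 - frac t).

Definition circle_measure : probability (measurableTypeR R) R :=
  uniform_prob (@ltr01 R).

Definition irrationality_exponent (alpha : R) : \bar R :=
  ereal_inf [set b%:E | b in [set b : R |
    (0 < limn_einf (fun q : nat =>
           (q%:R `^ b * dist_int (q%:R * alpha))%:E))%E]].

End Circle.
Arguments circle_measure R : clear implicits.

Section Skew.
Context (R : realType) (Om : pmetricType R).

Definition skew_product (T : Om -> Om) (phi : Om -> R) (alpha : R)
    (x : borel Om * measurableTypeR R) : borel Om * measurableTypeR R :=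
  (T x.1, frac ((x.2 : R) + alpha * phi x.1)).

Definition dist_M (x y : borel Om * measurableTypeR R) : R :=
  Num.max (@mdist R Om x.1 y.1) (dist_int ((x.2 : R) - (y.2 : R))).

(* For n = 0 the minimum is +oo. *)
Definition shortest_distance
    (S : borel Om * measurableTypeR R -> borel Om * measurableTypeR R)
    (n : nat) (x y : borel Om * measurableTypeR R) : \bar R :=
  \big[Order.min/+oo%E]_(i < n) \big[Order.min/+oo%E]_(j < n)
    (dist_M (iter i S x) (iter j S y))%:E.

End Skew.

(* Main.v *)
Require Import Defs.
From HB Require Import structures.
From mathcomp Require Import all_boot all_order all_algebra.
From mathcomp Require Import all_classical all_reals all_analysis.
From mathcomp Require Import measurable_realfun.
From mathcomp Require Import zify ring lra.

(* Upper bound for the liminf.  The circle distance between the orbits of (w, t)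
   and (w', t') is ||t - t' + m alpha|| with |m| at most the time.  If q alpha is
   within q^-b of an integer and n = q^b, this is at least ||q (t - t')|| / q up
   to a small error; by Borel-Cantelli ||q (t - t')|| is not too small along a
   lacunary sequence of such q, hence the shortest distance at time n is
   n^(-1/b + o(1)).

   Lower bound.  Fix the target x and move y.  For g' above the exponent, among
   the first 2^(k g') values of the number m of visits to I there are about
   2^(k (g' - 1)) values, with gaps of at least the O(k) symbols that locate a
   point at scale 2^-k, for which the circle coordinates are O(2^-k)-close.  At
   each of them the next O(k) symbols of y are fresh, and they are those of a
   point 2^-k-close to x with probability at least 2^(-k d') for any d' > d_mu.
   As g' - 1 > d', all trials fail with summable probability.

   Only the lower bound uses the measure mu, and it does so through words only,
   so that no measurability of the distance on Omega x Omega is needed. *)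

Set Implicit Arguments.
Unset Strict Implicit.
Unset Printing Implicit Defensive.

Import Order.TTheory GRing.Theory Num.Theory.
Import numFieldNormedType.Exports.

Local Open Scope classical_set_scope.
Local Open Scope ring_scope.

(** The trials of the lower bound are independent because the circle coordinate moves only at visits
    to [I]: the first time at which [m] visits have been counted is decided by the symbols already
    read, and a gap of [l] visits lasts at least [l] symbols, so the tested windows are disjoint.
    How long [m] visits take is random; words with too few symbols of [I] are discarded as
    improbable. The obstacle is that the closed sets [J i] may overlap along their boundaries, where
    itineraries are ambiguous. Since the Bernoulli weights add up to 1, almost every orbit avoids
    the overlaps; on these generic points the itinerary is unique, has the product law, and equal
    words mean close points because the coding is Hoelder. The strict inequality asks only for the
    crude bound [0 < C_nu <= 2 * (d_mu + 1)]: as the exponent exceeds [d_mu + 1], its inverse is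
    below [1 / (d_mu + 1)], which is at most [2 / C_nu]. *)

(** * Distance to the nearest integer *)

Section DistInt.
Context {R : realType}.
Implicit Types (s t alpha : R) (z : int).

Lemma frac_itv t : 0 <= Defs.frac t < 1.
Proof.
rewrite /Defs.frac; have := floor_itv t.
rewrite intrD => /andP[h1 h2]; lra.
Qed.

(** With [dist_int_le], this turns the fractional-part formula into a minimum over all integers,
    from which subadditivity, symmetry and periodicity follow. *)
Lemma dist_intP t : exists z, dist_int t = `|t - z%:~R|.
Proof.
rewrite /dist_int; have /andP[h0 h1] := frac_itv t.
case: (leP (Defs.frac t) (1 - Defs.frac t)) => h.
  by exists (Num.floor t); rewrite -[t - _]/(Defs.frac t) ger0_norm.
exists (Num.floor t + 1).
have -> : t - (Num.floor t + 1)%:~R = Defs.frac t - 1.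
  by rewrite intrD /Defs.frac; lra.
by rewrite ler0_norm ?opprB//; lra.
Qed.

Lemma dist_int_le t z : dist_int t <= `|t - z%:~R|.
Proof.
rewrite /dist_int; have /andP[h0 h1] := frac_itv t.
set f := Defs.frac t in h0 h1 *.
have e : t = f + (Num.floor t)%:~R by rewrite /f /Defs.frac subrK.
rewrite ge_min; apply/orP.
have -> : t - z%:~R = f + (Num.floor t - z)%:~R by rewrite {1}e intrB addrA.
have [h|h] := lerP 0 (Num.floor t - z).
  have : (0 : R) <= (Num.floor t - z)%:~R by rewrite ler0z.
  by move=> ?; left; rewrite ger0_norm; lra.
have : ((Num.floor t - z)%:~R : R) <= -1.
  by rewrite -(intrN _ 1) ler_int; lia.
by move=> ?; right; rewrite ler0_norm; lra.
Qed.

Lemma dist_int_ge0 t : 0 <= dist_int t.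
Proof. by have [z ->] := dist_intP t. Qed.

Lemma dist_intD s t : dist_int (s + t) <= dist_int s + dist_int t.
Proof.
have [z ->] := dist_intP s; have [y ->] := dist_intP t.
apply: le_trans (dist_int_le _ (z + y)) _.
by rewrite intrD opprD addrACA ler_normD.
Qed.

Lemma dist_intN t : dist_int (- t) = dist_int t.
Proof.
have h (x : R) : dist_int (- x) <= dist_int x.
  have [z ->] := dist_intP x; apply: le_trans (dist_int_le _ (- z)) _.
  by rewrite intrN -opprD normrN.
by apply/eqP; rewrite eq_le h -{1}(opprK t) h.
Qed.

Lemma dist_int_le_norm t : dist_int t <= `|t|.
Proof. by have := dist_int_le t 0; rewrite subr0. Qed.

Lemma dist_int_le1 t : dist_int t <= 1.
Proof.
have /andP[h0 h1] := frac_itv t.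
by rewrite /dist_int ge_min; apply/orP; left; lra.
Qed.

Lemma dist_intDz t z : dist_int (t + z%:~R) = dist_int t.
Proof.
have h (x : R) (y : int) : dist_int (x + y%:~R) <= dist_int x.
  have [a ->] := dist_intP x; apply: le_trans (dist_int_le _ (a + y)) _.
  by rewrite intrD opprD addrACA subrr addr0.
apply/eqP; rewrite eq_le h/=.
by have := h (t + z%:~R) (- z); rewrite intrN addrK.
Qed.

Lemma dist_intMn (n : nat) t : dist_int (n%:R * t) <= n%:R * dist_int t.
Proof.
elim: n => [|n IH].
  rewrite !mul0r; apply: le_trans (dist_int_le_norm _) _; by rewrite normr0.
by rewrite -natr1 !mulrDl !mul1r; apply: le_trans (dist_intD _ _) _; rewrite lerD2r.
Qed.

Lemma dist_intMz (m : int) t : dist_int (m%:~R * t) <= `|m|%:~R * dist_int t.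
Proof.
case: m => n; first by rewrite -pmulrn; exact: dist_intMn.
by rewrite NegzE intrN mulNr dist_intN normrN -pmulrn; exact: dist_intMn.
Qed.

Lemma dist_int_eq0 t : dist_int t = 0 -> exists z : int, t = z%:~R.
Proof.
have [z ->] := dist_intP t => /eqP; rewrite normr_eq0 subr_eq0 => /eqP ->.
by exists z.
Qed.

End DistInt.

(** * Returns of the rotation by [alpha] *)

Lemma pigeonhole_seq (T : Type) (D : nat) (b : T -> nat) (s : seq T) :
  all (fun x => b x < D)%N s -> (0 < D)%N ->
  exists j : nat, (size s <= D * count (fun x => b x == j) s)%N.
Proof.
move=> bD D0.
have e : (size s = \sum_(j < D) count (fun x => b x == j) s)%N.
  elim: s bD => [|x s IH] /=; first by rewrite big1.
  case/andP=> bx /IH ->.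
  rewrite big_split/= -add1n; congr addn.
  rewrite (bigD1 (Ordinal bx))//= eqxx big1 ?addn0// => i.
  by rewrite -val_eqE /= eq_sym => /negbTE ->.
apply/not_existsP => h.
have : (D * size s < D * size s)%N.
  rewrite {1}e big_distrr/=.
  apply: (@leq_trans (\sum_(j < D) (size s))); last first.
    by rewrite sum_nat_const card_ord.
  case: D D0 h {e bD} => // D _ h.
  rewrite !big_ord_recl/= -addSn leq_add//.
    by rewrite ltnNge; apply/negP/h.
  by apply: leq_sum => i _; rewrite leqNgt; apply/negP => /ltnW /h.
by rewrite ltnn.
Qed.

Section Returns.
Context {R : realType}.
Variable alpha : R.
Implicit Types (D l N q : nat) (s : R).

Definition gapped l := sorted (fun a b : nat => a + l <= b)%N.

(** The fractional parts of the [i * l * alpha], [i < N], fall into [D] boxes of width [1 / D]; in a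
    box holding at least [N / D] of them, the differences with the first index are the returns.
    Using multiples of [l] only is what creates the gaps, and [b = 0] is there for [l = 0]. *)
Lemma close_returns D l N : (0 < D)%N -> exists bs : seq nat,
  [/\ gapped l bs,
      {in bs, forall b, b < N * l \/ b = 0 :> nat}%N,
      {in bs, forall b, dist_int (b%:R * alpha) < D%:R^-1}
    & (N <= D * size bs)%N].
Proof.
move=> D0.
have DR : 0 < D%:R :> R by rewrite ltr0n.
pose x i : R := Defs.frac ((i * l)%:R * alpha).
pose b i := Num.truncn (D%:R * x i).
have xb i : (b i)%:R <= D%:R * x i < (b i).+1%:R.
  apply: truncn_itv; rewrite mulr_ge0//; by case/andP: (frac_itv ((i * l)%:R * alpha)).
have bD i : (b i < D)%N.
  rewrite -(ltr_nat R); case/andP: (xb i) => + _; move/le_lt_trans; apply.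
  by case/andP: (frac_itv ((i * l)%:R * alpha)) => _ h; rewrite -[ltRHS]mulr1 ltr_pM2l.
have [|j] := @pigeonhole_seq _ D b (iota 0 N) _ D0.
  by apply/allP => i _; exact: bD.
rewrite size_iota -size_filter.
set s := [seq _ <- _ | _] => hs.
have hsin i : i \in s -> b i = j /\ (i < N)%N.
  by rewrite mem_filter mem_iota add0n => /andP[/eqP -> /andP[_ ->]].
have sorteds : sorted ltn s by apply: sorted_filter (iota_ltn_sorted 0 N) => // ? ? ?; exact: ltn_trans.
case: s => [|i0 s] in hs hsin sorteds *.
  by exists [::]; split => // ; rewrite muln0 in hs.
exists [seq (i - i0) * l | i <- i0 :: s]%N; split.
- have : all (leq i0) (i0 :: s).
    rewrite /= leqnn/=; apply/allP => i /(allP (order_path_min ltn_trans sorteds)).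
    exact: ltnW.
  rewrite /gapped sorted_map.
  move: sorteds; rewrite -/(sorted _ (i0 :: s)).
  move=> h1 h2; move: h1.
  apply: (@sub_in_sorted _ (leq i0)) => //= a c ha hc /= ac.
  rewrite -mulSnr leq_mul2r; apply/orP; right.
  by rewrite /in_mem /= in ha hc; lia.
- move=> _ /mapP[i /hsin[_ iN] ->].
  have [->|l0] := posnP l; first by right; rewrite muln0.
  left; rewrite ltn_mul2r l0/=; apply: leq_ltn_trans iN; exact: leq_subr.
- move=> _ /mapP[i hi ->]; have [bi _] := hsin _ hi.
  have [b0 _] := hsin i0 (mem_head _ _).
  have i0i : (i0 <= i)%N.
    move: hi; rewrite inE => /orP[/eqP->//|hi].
    exact: ltnW (allP (order_path_min ltn_trans sorteds) _ hi).
  have -> : dist_int (((i - i0) * l)%:R * alpha) = dist_int (x i - x i0).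
    rewrite /x /Defs.frac mulnBl natrB ?leq_mul2r ?i0i ?orbT//.
    rewrite mulrBl.
    set u := _ * alpha; set v := _ * alpha.
    rewrite -(dist_intDz (u - v) (Num.floor v - Num.floor u)) intrB; congr dist_int; ring.
  apply: le_lt_trans (dist_int_le_norm _) _.
  rewrite -(ltr_pM2l DR) divff ?gt_eqF// -[X in X * _]ger0_norm ?ltW// -normrM.
  have := xb i; have := xb i0; rewrite bi b0 -natr1 => /andP[h1 h2] /andP[h3 h4].
  by rewrite ltr_norml mulrBr; apply/andP; split; lra.
- by rewrite size_map.
Qed.

(** For [l = 1] and [N = D + 1] some box has two members, and the second entry of the list is a
    nonzero return time. *)
Lemma dirichlet D : (0 < D)%N ->
  exists q, [/\ (0 < q <= D)%N & dist_int (q%:R * alpha) < D%:R^-1].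
Proof.
move=> D0; have [bs [g lt di sz]] := close_returns 1 D.+1 D0.
case: bs => [|a [|b bs]] in g lt di sz *.
- by rewrite muln0 in sz.
- by rewrite muln1 ltnn in sz.
- exists b; split; last by apply: di; rewrite !inE eqxx orbT.
  move: g => /= /andP[ab _].
  by have := lt b; rewrite !inE eqxx orbT => /(_ isT)[|]; lia.
Qed.

(** Here [alpha] is within [q ^ -2] of the reduced fraction [z / q], whose multiples by [m < q]
    visit every multiple of [1 / q] modulo 1. Rounding [s] costs [1 / q], and replacing [z / q] by
    [alpha] during [m < q] steps costs another [1 / q]. *)
Lemma rotation_covering q (z : int) (s : R) :
  (0 < q)%N -> coprimez z q -> `|q%:R * alpha - z%:~R| * q%:R <= 1 ->
  exists m, (m < q)%N /\ dist_int (s + m%:R * alpha) <= 2 / q%:R.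
Proof.
move=> q0 cop hq.
have qR : 0 < q%:R :> R by rewrite ltr0n.
case: (coprimezP _ _ cop) => -[u v] /= uv.
pose f := Num.floor (q%:R * s).
have := floor_itv (q%:R * s); rewrite -/f intrD => /andP[f1 f2].
(* [u] inverts [z] modulo [q], so [m * z = - f] modulo [q], and [s + m * z / q] lies in [[0, 1 / q)]
   modulo 1. *)
pose m := (modz (- f * u) q).
have m0 : 0 <= m by apply: modz_ge0; lia.
have mq : m < q by rewrite /m ltz_mod//; lia.
exists `|m|%N; split; first by lia.
have mm : (`|m|%N%:R : R) = m%:~R by rewrite pmulrn gez0_abs.
have [k hk] : exists k : int, m * z = - f + k * q.
  exists (- (v * - f) - (divz (- f * u) q) * z).
  have := divz_eq (- f * u) q; rewrite -/m => e.
  have -> : m = - f * u - divz (- f * u) q * q.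
    by apply/esym/eqP; rewrite subr_eq addrC -e.
  transitivity (- f * (u * z + v * q) + (- (v * - f) - divz (- f * u) q * z) * q).
    ring.
  by rewrite uv mulr1.
apply: le_trans (dist_int_le _ k) _.
rewrite mm.
have hkR : m%:~R * z%:~R = - f%:~R + k%:~R * q%:R :> R.
  by rewrite pmulrn -!intrM hk intrD intrN.
rewrite ler_pdivlMr// -[X in _ * X](ger0_norm (ltW qR)) -normrM.
have -> : (s + m%:~R * alpha - k%:~R) * q%:R =
   (q%:R * s - f%:~R) + m%:~R * (q%:R * alpha - z%:~R).
  transitivity (q%:R * s + m%:~R * (q%:R * alpha) - k%:~R * q%:R); first ring.
  have -> : k%:~R * q%:R = m%:~R * z%:~R + f%:~R :> R by rewrite hkR; ring.
  ring.
apply: le_trans (ler_normD _ _) _.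
have -> : 2 = 1 + 1 :> R by [].
apply: lerD; first by rewrite ger0_norm; lra.
rewrite normrM mulrC; apply: le_trans hq; apply: ler_wpM2l => //.
by rewrite ger0_norm ?ler0z// pmulrn ler_int ltW.
Qed.

(** Dirichlet at [Q] gives a fraction; in lowest terms its denominator [q] still satisfies
    [|q * alpha - z| < 1 / Q], so the hypothesis forces [2 * D <= q], while [q <= Q] makes
    [rotation_covering] applicable, with error [2 / q <= 1 / D]. *)
Lemma dense_orbit (D Q : nat) s :
  (forall q, (0 < q < 2 * D)%N -> Q%:R^-1 <= dist_int (q%:R * alpha)) ->
  (0 < Q)%N -> (0 < D)%N ->
  exists m, (m < Q)%N /\ dist_int (s + m%:R * alpha) <= D%:R^-1.
Proof.
move=> hQ Q0 D0.
have [q1 [/andP[q10 q1Q] hq1]] := @dirichlet Q Q0.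
have QR : 0 < Q%:R :> R by rewrite ltr0n.
have [z1 hz1] := dist_intP (q1%:R * alpha).
pose g := gcdz q1 z1.
have g0 : 0 < g.
  rewrite lt_def gcdz_eq0 negb_and; apply/andP; split=> //.
  by apply/orP; left; lia.
pose q := `|divz q1 g|%N; pose z := divz z1 g.
have eq1 : q1%:Z = q%:Z * g.
  have e : divz q1 g * g = q1 by rewrite divzK// dvdz_gcdl.
  by rewrite /q gez0_abs ?e// -(pmulr_lge0 _ g0) e.
have ez1 : z1 = z * g by rewrite /z divzK// dvdz_gcdr.
have q0 : (0 < q)%N by move: eq1 q10; case: q => //; lia.
have qq1 : (q <= q1)%N by rewrite -lez_nat eq1 ler_peMr//; lia.
have cop : coprimez z q.
  rewrite coprimez_sym /coprimez; apply/eqP.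
  have : gcdz (q%:Z * g) (z * g) = g by rewrite -eq1 -ez1.
  rewrite -mulz_gcdl gtz0_abs// => /eqP.
  by rewrite -[X in _ == X](mul1r g) (inj_eq (mulIf (lt0r_neq0 g0))) => /eqP.
have hq : `|q%:R * alpha - z%:~R| < Q%:R^-1.
  apply: le_lt_trans hq1; rewrite hz1.
  have -> : q1%:R * alpha - z1%:~R = g%:~R * (q%:R * alpha - z%:~R) :> R.
    by rewrite [q1%:R]pmulrn eq1 ez1 !intrM -pmulrn; ring.
  rewrite normrM ler_peMl// gtr0_norm ?ltr0z//.
  by rewrite ler1z; lia.
have qD : (2 * D <= q)%N.
  rewrite leqNgt; apply/negP => h.
  have := hQ q; rewrite q0 h => /(_ isT).
  by rewrite leNgt (le_lt_trans (dist_int_le _ z) hq).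
have [|m [mq hm]] := @rotation_covering q z s q0 cop.
  rewrite -ler_pdivlMr ?ltr0n// mul1r.
  apply: le_trans (ltW hq) _.
  by rewrite lef_pV2 ?posrE ?ltr0n// ler_nat; lia.
exists m; split; first by lia.
apply: le_trans hm _.
have DR : 0 < D%:R :> R by rewrite ltr0n.
rewrite ler_pdivrMr ?ltr0n// mulrC ler_pdivlMr//.
by rewrite -natrM ler_nat.
Qed.

(* The passage near [- s] given by [dense_orbit] is followed by close returns. *)
Lemma many_returns (D Q l N : nat) s :
  (forall q, (0 < q < 2 * D)%N -> Q%:R^-1 <= dist_int (q%:R * alpha)) ->
  (0 < Q)%N -> (0 < D)%N ->
  exists ms : seq nat,
  [/\ gapped l ms,
      {in ms, forall m, m < Q + N * l}%N,
      {in ms, forall m, dist_int (s + m%:R * alpha) <= 2 / D%:R}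
    & (N <= D * size ms)%N].
Proof.
move=> hQ Q0 D0.
have [m0 [m0Q hm0]] := dense_orbit s hQ Q0 D0.
have [bs [g lt di sz]] := @close_returns D l N D0.
exists [seq m0 + b | b <- bs]%N; split.
- rewrite /gapped sorted_map; move: g; apply: sub_sorted => a b /=.
  by rewrite -addnA leq_add2l.
- by move=> _ /mapP[b /lt hb ->]; lia.
- move=> _ /mapP[b /di hb ->]; rewrite natrD mulrDl addrA.
  apply: le_trans (dist_intD _ _) _.
  by rewrite mulrDl !mul1r lerD// ltW.
- by rewrite size_map.
Qed.

End Returns.

(** * Random words with independent letters *)

Section Words.
Context {R : realType} {p : nat}.
Variable w : 'I_p -> R.
Hypothesis w_ge0 : forall i, 0 <= w i.
Hypothesis w_sum : \sum_i w i = 1.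
Implicit Types (f g : seq 'I_p -> R) (u v : seq 'I_p) (P Q : pred (seq 'I_p)).

(** Integration against the product law on words of length [n], written as an iterated finite sum:
    independence of consecutive blocks is then the identity [expect_cat]. *)
Fixpoint expect n f : R :=
  if n is n'.+1 then \sum_i w i * expect n' (fun u => f (i :: u)) else f [::].

Definition prob n P := expect n (fun u => (P u)%:R).

Lemma expect_le n f g : (forall u, size u = n -> f u <= g u) ->
  expect n f <= expect n g.
Proof.
elim: n f g => [|n IH] f g fg /=; first exact: fg.
by apply: ler_sum => i _; apply: ler_wpM2l => //; apply: IH => u su; apply: fg; rewrite /= su.
Qed.

Lemma eq_expect n f g : (forall u, size u = n -> f u = g u) ->
  expect n f = expect n g.
Proof. by move=> fg; apply/eqP; rewrite eq_le !expect_le// => u /fg ->. Qed.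

Lemma expect_cst n (c : R) : expect n (fun=> c) = c.
Proof. by elim: n => //= n ->; rewrite -mulr_suml w_sum mul1r. Qed.

Lemma expectD n f g : expect n (fun u => f u + g u) = expect n f + expect n g.
Proof.
elim: n f g => //= n IH f g; rewrite -big_split/=.
by apply: eq_bigr => i _; rewrite IH mulrDr.
Qed.

Lemma expectZ n (c : R) f : expect n (fun u => c * f u) = c * expect n f.
Proof.
elim: n f => //= n IH f; rewrite mulr_sumr; apply: eq_bigr => i _.
by rewrite IH mulrCA.
Qed.

Lemma expect_cat m n f :
  expect (m + n) f = expect m (fun u => expect n (fun v => f (u ++ v))).
Proof. by elim: m f => //= m IH f; apply: eq_bigr => i _; rewrite IH. Qed.

Lemma prob_le1 n P : prob n P <= 1.
Proof.
have <- : expect n (fun=> 1) = 1 by exact: expect_cst.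
by apply: expect_le => u _; rewrite lern1 leq_b1.
Qed.

Lemma prob_le n P Q : (forall u, size u = n -> P u -> Q u) -> prob n P <= prob n Q.
Proof.
move=> PQ; apply: expect_le => u su; rewrite ler_nat.
by case: (P u) (PQ u su) => // ->.
Qed.

Lemma prob_or n P Q : prob n (predU P Q) <= prob n P + prob n Q.
Proof.
by rewrite -expectD; apply: expect_le => u _ /=; rewrite -natrD ler_nat; case: (P u); case: (Q u).
Qed.

Lemma probC n P : prob n (predC P) = 1 - prob n P.
Proof.
have <- : expect n (fun=> 1) = 1 by exact: expect_cst.
apply/eqP; rewrite eq_sym subr_eq -expectD; apply/eqP.
by apply: eq_expect => u _ /=; case: (P u); rewrite ?addr0 ?add0r.
Qed.

Variable a : pred 'I_p.

(* Markov inequality for [2 ^- count a u], whose expectation is the last factor. *)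
Lemma prob_count_lt n X :
  prob n (fun u => count a u < X)%N <=
  2 ^+ X * (1 - (\sum_(i | a i) w i) / 2) ^+ n.
Proof.
have e : expect n (fun u => 2^-1 ^+ count a u) = (1 - (\sum_(i | a i) w i) / 2) ^+ n.
  elim: n => [|n IH] //=; rewrite exprS -IH.
  under eq_bigr do under eq_expect do rewrite exprD.
  under eq_bigr do rewrite expectZ mulrA.
  rewrite -mulr_suml; congr *%R.
  have <- : \sum_i w i - (\sum_(i | a i) w i) / 2 = 1 - (\sum_(i | a i) w i) / 2.
    by rewrite w_sum.
  rewrite (bigID a)/= [X in _ = X - _](bigID a)/=.
  rewrite (eq_bigr (fun i => w i / 2)); last by move=> i ->; rewrite expr1.
  rewrite [X in _ + X](eq_bigr w); last by move=> i /negbTE ->; rewrite expr0 mulr1.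
  by rewrite -mulr_suml; lra.
rewrite -e -expectZ; apply: expect_le => u _.
case: ltnP => h; last by rewrite mulr_ge0// exprn_ge0// invr_ge0.
rewrite -(subnK (ltnW h)) exprD -mulrA -exprMn divff// expr1n mulr1.
by rewrite exprn_ege1// ler1n.
Qed.

Variables (l : nat) (V : pred (seq 'I_p)).

(* After a prefix of [u] containing [m - c] symbols of [a], for some [m] in
   [ms], the next [l] symbols do not form a word of [V]. *)
Definition nohit (c : nat) (ms : seq nat) u :=
  all (fun m => all (fun i =>
    (c + count a (take i u) == m) ==> ~~ V (take l (drop i u)))
    (iota 0 (size u).+1)) ms.
Arguments nohit : simpl never.

Lemma nohitP c ms u : reflect
  (forall m i, m \in ms -> (i <= size u)%N -> (c + count a (take i u))%N = m ->
     ~~ V (take l (drop i u))) (nohit c ms u).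
Proof.
apply: (iffP allP) => [h m i /h /allP + iu /eqP e|h m mms].
  by move/(_ i); rewrite mem_iota ltnS iu => /(_ isT); rewrite e.
apply/allP => i; rewrite mem_iota add0n ltnS => /andP[_ iu].
by apply/implyP => /eqP; exact: h.
Qed.

(** The requirement [X <= c + count a u] guarantees that every trial takes place. The induction is
    on [n], with [c] the visits already made and [m] the next trial. If [c < m], one letter is read,
    raising [c] by at most 1. If [c = m], the next [l] letters are the trial: independent of the
    rest, it costs a factor [1 - prob l V] and raises [c] by at most [l], hence not beyond the next
    member of [ms]. If fewer than [m + l - c] letters remain, [X] visits are out of reach. *)
Lemma prob_nohit n c X ms : (0 < l)%N -> gapped l ms -> all (leq c) ms ->
  {in ms, forall m, (m + l <= X)%N} ->
  prob n (fun u => nohit c ms u && (X <= c + count a u)%N) <=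
  (1 - prob l V) ^+ size ms.
Proof.
move=> l0.
have k0 : 0 <= 1 - prob l V by rewrite subr_ge0 prob_le1.
have empty k (Q : pred (seq 'I_p)) x : 0 <= x ->
    (forall u, size u = k -> ~~ Q u) -> prob k Q <= x.
  move=> x0 h; apply: le_trans x0; rewrite -(expect_cst k 0).
  by apply: expect_le => u /h /negbTE ->.
elim/ltn_ind: n c ms => n IH c [|m ms] gms cms msX.
  by rewrite expr0 prob_le1.
have cm : (c <= m)%N by case/andP: cms.
have mX : (m + l <= X)%N by apply: msX; rewrite mem_head.
have [nl|ln] := ltnP (n + c) (m + l).
  apply: empty; first by rewrite exprn_ge0.
  move=> u su; apply/negP => /andP[_]; have := count_size a u; rewrite su; lia.
move: cm; rewrite leq_eqVlt => /orP[/eqP cm|cm]; last first.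
  case: n => [|n] in IH ln *; first lia.
  have h i : prob n (fun u => nohit (c + a i) (m :: ms) u &&
      (X <= c + a i + count a u)%N) <= (1 - prob l V) ^+ (size ms).+1.
    apply: (IH n (ltnSn n)) => //.
    have ci : (c + a i <= m)%N by case: (a i); lia.
    have := order_path_min _ gms => /(_ _)/allP hm.
    apply/allP => m'; rewrite inE => /orP[/eqP ->//|m'ms].
    apply: leq_trans ci _; apply: leq_trans (leq_addr l _) _; apply: hm => // ? ? ?; lia.
  rewrite -[leRHS](expect_cst n.+1)/=; apply: ler_sum => i _.
  apply: ler_wpM2l => //; rewrite expect_cst; apply: le_trans (h i).
  apply: prob_le => u _ /andP[/nohitP nh hX]; apply/andP; split.
    by apply/nohitP => m' j m'ms ju e; apply: (nh m' j.+1) => //=; rewrite addnA.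
  by rewrite -addnA.
subst m.
have lN : (l <= n)%N by lia.
rewrite -(subnKC lN) /prob expect_cat exprS.
have h v : size v = l -> prob (n - l) (fun u => nohit (c + count a v) ms u &&
      (X <= c + count a v + count a u)%N) <= (1 - prob l V) ^+ (size ms).
  move=> sv; apply: IH; first lia.
  - exact: path_sorted gms.
  - have := order_path_min _ gms => /(_ _)/allP hm.
    apply/allP => m' m'ms; apply: (@leq_trans (c + l)).
      by rewrite leq_add2l -sv count_size.
    by apply: hm => // ? ? ?; lia.
  - by move=> m' m'ms; apply: msX; rewrite inE m'ms orbT.
have : expect l (fun v => (predC V v)%:R * (1 - prob l V) ^+ size ms) =
       (1 - prob l V) * (1 - prob l V) ^+ size ms.
  rewrite -probC mulrC -expectZ; apply: eq_expect => u _; exact: mulrC.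
move=> <-; apply: expect_le => v sv /=.
have [Vv|nVv] /= := boolP (V v).
  rewrite mul0r; apply: empty => // u su; apply/negP => /andP[/nohitP nh _].
  have := nh c 0 (mem_head _ _) isT; rewrite take0/= addn0 drop0 take_size_cat//.
  by move=> /(_ erefl); rewrite Vv.
rewrite mul1r; apply: le_trans (h v sv); apply: prob_le => u su /andP[/nohitP nh hX].
apply/andP; split; last by rewrite count_cat addnA in hX.
apply/nohitP => m' j m'ms ju e.
have dr : drop (size v + j) (v ++ u) = drop j u.
  by rewrite drop_cat ltnNge leq_addr/= addKn.
have tk : take (size v + j) (v ++ u) = v ++ take j u.
  by rewrite take_cat ltnNge leq_addr/= addKn.
rewrite -dr; apply: (nh m').
- by rewrite inE m'ms orbT.
- by rewrite size_cat leq_add2l.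
- by rewrite tk count_cat addnA.
Qed.

End Words.

(** * Generic points and the law of itineraries *)

Section CountableNegligible.
Context d (X : measurableType d) (R : realType) (m : {measure set X -> \bar R}).

Lemma negligible_countable (I : countType) (F : I -> set X) :
  (forall i, m.-negligible (F i)) -> m.-negligible (\bigcup_i F i).
Proof.
move=> nF; pose G n := if unpickle n is Some i then F i else set0.
apply: (@negligibleS _ _ _ _ (\bigcup_n G n)).
  by move=> x [i _ Fx]; exists (pickle i) => //; rewrite /G pickleK.
apply: negligible_bigcup => n; rewrite /G; case: unpickle => [i//|].
exact: negligible_set0.
Qed.

End CountableNegligible.

Section Itineraries.
Context {R : realType} {Om : pmetricType R} {p : nat}.
Variables (J : 'I_p -> set Om) (T : Om -> Om) (mu : probability (borel Om) R).
Hypothesis Jcover : forall w, exists i, J i w.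

(** An arbitrary choice where several [J i] overlap; on [generic] points it is forced, and having a
    given word then means lying in a closed cylinder. *)
Definition symbol (w : Om) : 'I_p := sval (cid (Jcover w)).

Definition word (n : nat) (w : Om) : seq 'I_p :=
  mkseq (fun k => symbol (iter k T w)) n.
Arguments word : simpl never.

Definition generic : set Om :=
  [set w | forall k i j, J i (iter k T w) -> J j (iter k T w) -> i = j].

Lemma symbolP w : J (symbol w) w.
Proof. by rewrite /symbol; case: cid. Qed.

Lemma generic_symbol w k i : generic w -> J i (iter k T w) ->
  i = symbol (iter k T w).
Proof. by move=> gw Ji; apply: gw Ji (symbolP _). Qed.

Lemma generic_iter w k : generic w -> generic (iter k T w).
Proof. by move=> gw m i j; rewrite -iterD; apply: gw. Qed.

Lemma size_word n w : size (word n w) = n.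
Proof. by rewrite size_mkseq. Qed.

Lemma subword n l i w : (i + l <= n)%N ->
  take l (drop i (word n w)) = word l (iter i T w).
Proof.
move=> iln; apply: (@eq_from_nth _ (symbol w)).
  by rewrite size_take size_drop !size_word; case: ltnP; lia.
move=> k; rewrite size_take_min size_drop size_word => kl.
have {}kl : (k < l)%N by lia.
rewrite nth_take// nth_drop !nth_mkseq//; last by lia.
by rewrite addnC iterD.
Qed.

Lemma take_word n l w : (l <= n)%N -> take l (word n w) = word l w.
Proof. by move=> ln; have := @subword n l 0 w; rewrite drop0; exact. Qed.

Lemma eq_word n w w' : word n w = word n w' ->
  forall k, (k < n)%N -> symbol (iter k T w) = symbol (iter k T w').
Proof.
move=> e k kn; have := congr1 (fun s => nth (symbol w) s k) e.
by rewrite !nth_mkseq.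
Qed.

Lemma borel_open (A : set Om) : open A -> measurable (A : set (borel Om)).
Proof. by move=> ?; apply: sub_sigma_algebra. Qed.

Lemma borel_closed (A : set Om) : closed A -> measurable (A : set (borel Om)).
Proof.
move=> ?; rewrite -(setCK A); apply: measurableC; apply: borel_open.
exact: closed_openC.
Qed.

Hypothesis Jclosed : forall i, closed (J i).
Hypothesis Tinv : invariant_measure mu T.
Hypothesis bern : bernoulli_measure J T mu.

Let mJ i : measurable (J i : set (borel Om)).
Proof. exact: borel_closed. Qed.

Lemma measurable_preimage_iter k (A : set (borel Om)) : measurable A ->
  measurable (iter k T @^-1` A : set (borel Om)).
Proof.
elim: k A => //= k IH A mA.
have -> : (fun x => T (iter k T x)) @^-1` A = iter k T @^-1` (T @^-1` A) by [].
by apply: IH; rewrite -[_ @^-1` _]setTI; apply: Tinv.1.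
Qed.

Lemma measure_preimage_iter k (A : set (borel Om)) : measurable A ->
  mu (iter k T @^-1` A) = mu A.
Proof.
elim: k A => //= k IH A mA.
have -> : (fun x => T (iter k T x)) @^-1` A = iter k T @^-1` (T @^-1` A) by [].
rewrite IH ?Tinv.2//.
by rewrite -[_ @^-1` _]setTI; apply: Tinv.1.
Qed.

Let mu_fin (A : set (borel Om)) : measurable A -> (mu A = (fine (mu A))%:E)%E.
Proof. by move=> mA; rewrite fineK// fin_num_measure. Qed.

(** Replacing [J i] by [J i] minus [J j] in the family leaves a cover of the space. The masses still
    add up to at least 1, while the original weights add up to exactly 1, so the removed part is
    null. *)
Lemma overlap_null i j : i != j -> mu (J i `&` J j) = 0%E.
Proof.
move=> ij; have [_ s1 _] := bern.
pose K k := if k == i then J i `\` J j else J k.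
have mK k : measurable (K k : set (borel Om)).
  by rewrite /K; case: ifP => // _; apply: measurableD.
have mI : measurable (J i `&` J j : set (borel Om)) by exact: measurableI.
have mD : measurable (J i `\` J j : set (borel Om)) by exact: measurableD.
have h : (1 <= \sum_(k < p) mu (K k))%E.
  rewrite -(probability_setT mu).
  have -> : setT = \big[setU/set0]_(k < p) K k :> set (borel Om).
    apply/seteqP; split=> // w _.
    have [k Kk] : exists k, K k w.
      have [k Jk] := Jcover w.
      have [Jj|nJj] := pselect (J j w).
        by exists j => //; rewrite /K eq_sym (negbTE ij).
      by exists k => //; rewrite /K; case: eqP => // <-.
    by rewrite (bigD1 k)//=; left.
  elim: (index_enum _) => [|k s IH]; first by rewrite !big_nil measure0.
  rewrite !big_cons; apply: le_trans (measureU2 _ _ _) _ => //.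
    exact: bigsetU_measurable.
  exact: leeD2l.
have sJ : (\sum_(k < p) mu (J k) = 1)%E.
  by rewrite -[1%E]/(1%:E) -s1 -sumEFin; apply: eq_bigr => k _; exact: mu_fin.
move: h; rewrite -sJ (bigD1 i)//= [leRHS](bigD1 i)//= /K eqxx.
rewrite [X in (_ <= _ + X)%E](eq_bigr (fun k => mu (J k))); last first.
  by move=> k /negbTE ->.
rewrite (eq_bigr (fun k => (fine (mu (J k)))%:E)); last by move=> k _; exact: mu_fin.
rewrite sumEFin leeD2rE//.
have -> : mu (J i) = (mu (J i `&` J j) + mu (J i `\` J j))%E.
  rewrite -measureU//; first by rewrite setUIDK.
  by rewrite setDE setIACA setICr setI0.
rewrite (mu_fin mI) (mu_fin mD) -EFinD lee_fin => h.
by congr EFin; apply/eqP; rewrite eq_le fine_ge0// andbT; lra.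
Qed.

Let overlaps : set (borel Om) :=
  \bigcup_(x : nat * ('I_p * 'I_p))
    if x.2.1 == x.2.2 then set0 else iter x.1 T @^-1` (J x.2.1 `&` J x.2.2).

Let genericE : generic = ~` overlaps.
Proof.
apply/seteqP; split=> w.
  move=> gw [[k [i j]] _ /=]; case: eqP => // ij [Ji Jj].
  exact/ij/(gw k).
move=> nw k i j Ji Jj; apply: contrapT => ij; apply: nw.
by exists (k, (i, j)) => //=; case: eqP.
Qed.

Lemma measurable_generic : measurable (generic : set (borel Om)).
Proof.
rewrite genericE; apply: measurableC.
apply: countable_bigcupT_measurable => //= x.
by case: ifP => // _; apply: measurable_preimage_iter; apply: measurableI.
Qed.

Lemma generic_null : mu.-negligible (~` generic).
Proof.
rewrite genericE setCK; apply: negligible_countable => x.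
case: ifPn => [_|ij]; first exact: negligible_set0.
have mI : measurable (J x.2.1 `&` J x.2.2 : set (borel Om)) by exact: measurableI.
apply/negligibleP; first exact: measurable_preimage_iter.
by apply: etrans (measure_preimage_iter _ mI) _; exact: overlap_null.
Qed.

Lemma measure_genericI (A : set (borel Om)) : measurable A ->
  mu (generic `&` A) = mu A.
Proof.
move=> mA; apply/eqP; rewrite eq_le; have mG := measurable_generic.
apply/andP; split; first by rewrite le_measure ?inE//; exact: measurableI.
have mN : measurable (~` generic `&` A : set (borel Om)).
  by apply: measurableI => //; exact: measurableC.
have AE : A = (generic `&` A) `|` (~` generic `&` A).
  by rewrite -setIUl setUv setTI.
rewrite [X in (mu X <= _)%E]AE.
apply: le_trans (measureU2 _ _ _) _ => //; first exact: measurableI.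
rewrite [X in (_ + X <= _)%E](_ : _ = 0%E) ?adde0//.
by apply: measure_negligible => //; apply: negligibleS generic_null; exact: subIsetl.
Qed.

Definition word_in n (P : pred (seq 'I_p)) : set (borel Om) :=
  generic `&` [set w | P (word n w)].

Let weight i := fine (mu (J i)).

Lemma measurable_measure_cylinder n (u : seq 'I_p) : size u = n ->
  measurable (word_in n (pred1 u)) /\
  mu (word_in n (pred1 u)) = (\prod_(i <- u) weight i)%:E.
Proof.
move=> su; pose a (k : 'I_n) := tnth (in_tuple u) (cast_ord (esym su) k).
have -> : word_in n (pred1 u) = generic `&` cylinder J T a.
  apply/seteqP; split => w [gw uw]; split => //.
    move=> k /=; have /eqP e := uw.
    have -> : a k = symbol (iter k T w).
      by rewrite /a (tnth_nth (symbol w)) /= -e nth_mkseq.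
    exact: symbolP.
  apply/eqP; apply: (@eq_from_nth _ (symbol w)); rewrite size_word// => k kn.
  rewrite nth_mkseq//; have := uw (Ordinal kn) => /(generic_symbol gw) <-.
  by rewrite /a (tnth_nth (symbol w)).
have mc : measurable (cylinder J T a : set (borel Om)).
  rewrite (_ : cylinder J T a = \bigcap_(k : 'I_n) iter k T @^-1` J (a k)).
    by apply: fin_bigcap_measurable => // k _; exact: measurable_preimage_iter.
  by apply/seteqP; split => w h k; [move=> _|]; exact: h.
split; first exact: measurableI measurable_generic mc.
rewrite measure_genericI// mu_fin//; congr EFin.
have [_ _ ->] := bern.
rewrite /a (big_tnth _ _ u) /= (reindex (cast_ord (esym su)))//=.
by exists (cast_ord su) => k _; rewrite ?cast_ordK ?cast_ordKV.
Qed.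

Lemma measurable_word_in n P : measurable (word_in n P).
Proof.
rewrite (_ : word_in n P = \bigcup_(u : seq 'I_p)
    if (size u == n) && P u then word_in n (pred1 u) else set0).
  apply: countable_bigcupT_measurable => //= u; case: ifP => // /andP[/eqP su _].
  by have [] := measurable_measure_cylinder su.
apply/seteqP; split => w.
  by move=> [gw Pw]; exists (word n w) => //; rewrite size_word eqxx Pw; split => //=.
by move=> [u _]; case: ifP => // /andP[_ Pu] [gw /= /eqP e]; split => //=; rewrite e.
Qed.

(** The itinerary has the product law, so probabilities under [mu] become finite sums over words. *)
Lemma measure_word_in n P : mu (word_in n P) = (prob weight n P)%:E.
Proof.
(* [expect] peels off the first unread letter, so the induction carries a prefix [v] already
   read. *)
have h m v (Q : pred (seq 'I_p)) : size v = m ->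
    mu (word_in (m + n) (fun u => prefix v u && Q (drop m u))) =
    (\prod_(i <- v) weight i * prob weight n Q)%:E.
  elim: n m v Q => [|n IH] m v Q sv.
    rewrite addn0 /prob /=.
    have e w : prefix v (word m w) = (word m w == v).
      by rewrite prefixE sv -[X in take X](size_word m w) take_size.
    have [q0|q0] := boolP (Q [::]).
      rewrite mulr1; have [_ <-] := measurable_measure_cylinder sv; congr (mu _).
      have eP w : prefix v (word m w) && Q (drop m (word m w)) = (word m w == v).
        by rewrite e drop_oversize ?size_word// q0 andbT.
      by apply/seteqP; split => w [gw] /= h; split => //=; move: h; rewrite eP.
    rewrite mulr0 (_ : word_in _ _ = set0) ?measure0// -subset0 => w [gw] /=.
    by rewrite drop_oversize ?size_word// (negbTE q0) andbF.
  pose F (i : 'I_p) := word_in (m + n.+1)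
    (fun u => prefix (rcons v i) u && Q (i :: drop m.+1 u)).
  have pre i u : size u = (m + n.+1)%N ->
      prefix (rcons v i) u = prefix v u && (drop m u == i :: drop m.+1 u).
    move=> su; rewrite !prefixE size_rcons sv.
    rewrite (drop_nth i) ?su; last lia.
    rewrite (take_nth i) ?su; last lia.
    by rewrite eqseq_rcons eqseq_cons eqxx andbT.
  have -> : word_in (m + n.+1) (fun u => prefix v u && Q (drop m u)) =
      \big[setU/set0]_(i < p) F i.
    apply/seteqP; split => w.
      move=> [gw /andP[pw Qw]]; have sw := size_word (m + n.+1) w.
      rewrite (bigD1 (nth (symbol w) (word (m + n.+1) w) m))//=; left.
      split => //=; rewrite pre// pw/= -drop_nth ?eqxx// sw; lia.
    move: w; rewrite -/(_ `<=` _); elim/big_ind: _ => [//|A B hA hB|i _ w].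
      by rewrite subUset.
    move=> [gw /andP[]]; rewrite pre ?size_word// => /andP[pw /eqP e] Qw.
    by split => //=; rewrite pw e.
  rewrite measure_bigsetU_ord//; first last.
  - move=> i j _ _ [w [[_ /andP[pi _]] [_ /andP[pj _]]]]; move: pi pj.
    by rewrite !pre ?size_word// => /andP[_ /eqP ->] /andP[_ /eqP[]].
  - by move=> i; exact: measurable_word_in.
  rewrite (eq_bigr (fun i => (\prod_(j <- rcons v i) weight j *
     prob weight n (fun u => Q (i :: u)))%:E)); last first.
    move=> i _; have := IH m.+1 (rcons v i) (fun u => Q (i :: u)).
    by rewrite size_rcons sv addSnnS => /(_ erefl) <-.
  rewrite sumEFin; congr EFin; rewrite /prob/= mulr_sumr; apply: eq_bigr => i _.
  by rewrite -cats1 big_cat big_seq1/= mulrA.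
have := h 0 [::] P erefl; rewrite big_nil mul1r add0n.
have -> : (fun u => prefix [::] u && P (drop 0 u)) = P by apply/funext => u; rewrite prefix0s drop0.
exact.
Qed.

End Itineraries.

(** * Coding of generic points, and the mass of balls *)

Section Coding.
Context {R : realType} {Om : pmetricType R} {p : nat}.
Variables (J : 'I_p -> set Om) (T : Om -> Om) (mu : probability (borel Om) R).
Hypothesis Jcover : forall w, exists i, J i w.
Hypothesis Jclosed : forall i, closed (J i).
Hypothesis Tinv : invariant_measure mu T.
Hypothesis bern : bernoulli_measure J T mu.
Variable pi : (nat -> 'I_p) -> Om.
Hypothesis Hpi : semi_conjugacy J T pi.

Local Notation symbol := (symbol Jcover).
Local Notation word := (word T Jcover).
Local Notation generic := (generic J T).
Local Notation weight := (fun i => fine (mu (J i))).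

(** The other [J j] form a closed union missing [w], and off this union the cover leaves only [J i].
    The intertwining relation of the coding, given at interior points, thus holds along generic
    orbits. *)
Lemma generic_interior w i : generic w -> J i w -> (J i)° w.
Proof.
move=> gw Ji; pose B := \big[setU/set0]_(j < p | j != i) J j.
have cB : closed B.
  by rewrite /B; elim/big_ind: _ => // [|X Y]; [exact: closed0 | exact: closedU].
have BP v : ~ B v -> J i v.
  move=> nB; have [j Jj] := Jcover v.
  have [<-//|ji] := eqVneq j i; case: nB.
  by rewrite /B (bigD1 j)//=; left.
have nBw : ~ B w.
  have : B `<=` ~` [set w]; last by move=> /(_ w) h /h; exact.
  rewrite /B; elim/big_ind: _ => [//|X Y hX hY|j /eqP ji v Jj /= vw].
    by rewrite subUset.
  by apply: ji; apply: (gw 0 _ _ _ Ji) => /=; rewrite -vw.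
rewrite /interior /=; apply: (@filterS _ (nbhs w) _ (~` B)) => //.
by apply: open_nbhs_nbhs; split => //; exact: closed_openC.
Qed.

(** Any preimage under [pi] codes the itinerary: the orbit stays in interiors, so [pi] intertwines
    the maps at each step, and genericity leaves one possible symbol. *)
Lemma generic_coding w : generic w -> exists x,
  [/\ subshift J T x, w = pi x & forall k, x k = symbol (iter k T w)].
Proof.
move=> gw; have : [set: Om] w by []. rewrite -(sc_onto Hpi) => -[x sx xw].
exists x; split=> // k.
suff [s e Jk] : [/\ subshift J T (iter k (@shift_seq _) x),
    iter k T w = pi (iter k (@shift_seq p) x)
    & J (x k) (iter k T w)].
  exact: (generic_symbol Jcover gw Jk).
have sh y m : iter m (@shift_seq p) y 0%N = y m.
  elim: m y => // m IH y; rewrite iterSr IH; congr y; lia.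
elim: k => [|k [s e Jk]] /=.
  by split => //; rewrite -xw; exact: (sc_mem Hpi).
have e' : T (iter k T w) = pi (shift_seq (iter k (@shift_seq p) x)).
  rewrite e; apply: (sc_conj Hpi) => //; rewrite sh -e.
  by apply: generic_interior => //; exact: generic_iter.
have s' : subshift J T (shift_seq (iter k (@shift_seq p) x)).
  by move=> m; apply: s.
split => //; rewrite e' -[x k.+1]/(shift_seq x k) -sh -iterSr iterS.
exact: (sc_mem Hpi).
Qed.

Lemma generic_word_dist : exists C theta : R, [/\ 0 < theta < 1, 0 <= C
  & forall l w w', generic w -> generic w' -> word l w = word l w' ->
    mdist w w' <= C * theta ^+ l].
Proof.
have [C [theta [th h]]] := sc_holder Hpi.
exists `|C|, theta; split => // l w w' gw gw' ww'.
have [x [sx wx ex]] := generic_coding gw.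
have [x' [sx' wx' ex']] := generic_coding gw'.
rewrite wx wx'; apply: le_trans (h x x' l sx sx' _) _.
  by move=> j jl; rewrite ex ex'; exact: eq_word ww' _ jl.
by rewrite ler_wpM2r ?ler_norm// exprn_ge0//; case/andP: th => /ltW.
Qed.

(** A substitute for the ball that depends on words only. Being existential, it is loose enough for
    the words near that of [w] to carry at least the mass of the [r]-ball at [w], yet it keeps
    points within [r] plus two cylinder diameters. *)
Definition near_words l (r : R) : rel (seq 'I_p) := fun u v =>
  `[< exists w w', [/\ generic w, generic w', word l w = u, word l w' = v
      & mdist w w' < r] >].

Lemma open_mball (w : Om) (r : R) : open [set v | mdist w v < r].
Proof.
rewrite openE => v /= wv; rewrite /interior /=; apply/nbhs_ballP.
exists (r - mdist w v) => /=; first by rewrite subr_gt0.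
rewrite ballEmdist => u /= vu; apply: le_lt_trans (metric_triangle _ v _) _.
by rewrite addrC -ltrBrDr.
Qed.

Lemma measurable_mball w r : measurable ([set v | mdist w v < r] : set (borel Om)).
Proof. by apply: borel_open; exact: open_mball. Qed.

Lemma measure_mball_le l r w : generic w ->
  fine (mu [set v | mdist w v < r]) <= prob weight l (near_words l r (word l w)).
Proof.
move=> gw; rewrite -lee_fin fineK ?fin_num_measure//; last first.
  exact: measurable_mball.
rewrite -(measure_word_in Jcover Jclosed Tinv bern).
rewrite -(measure_genericI Jcover Jclosed Tinv bern); last exact: measurable_mball.
apply: le_measure; rewrite ?inE.
- apply: measurableI; first exact: (measurable_generic Jclosed Tinv).
  exact: measurable_mball.
- exact: (measurable_word_in Jcover Jclosed Tinv bern).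
- by move=> v [gv wv]; split => //; apply/asboolP; exists w, v.
Qed.

(** The generic points sharing a long enough word with [w] lie in the ball, and their mass is a
    product of positive weights. *)
Lemma measure_mball_gt0 r w : generic w -> 0 < r ->
  0 < fine (mu [set v | mdist w v < r]).
Proof.
move=> gw r0; have [C [theta [/andP[t0 t1] C0 h]]] := generic_word_dist.
have [l hl] : exists l, C * theta ^+ l < r.
  have [C00|C0'] := eqVneq C 0; first by exists 0; rewrite C00 mul0r.
  have /cvgrPdist_lt/(_ (r / C)) : theta ^+ n @[n --> \oo] --> (0 : R).
    by apply: cvg_expr; rewrite ger0_norm// ltW.
  have Cp : 0 < C by rewrite lt_def C0'.
  rewrite divr_gt0// => /(_ isT)[N _ /(_ N (leqnn N))] /=.
  rewrite sub0r normrN ger0_norm ?exprn_ge0 ?ltW// => hN.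
  by exists N; rewrite mulrC -ltr_pdivlMr.
have [mc mE] := measurable_measure_cylinder Jcover Jclosed Tinv bern (size_word T Jcover l w).
apply: (@lt_le_trans _ _ (\prod_(i <- word l w) weight i)).
  by apply: prodr_gt0 => i _; have [] := bern.
rewrite -lee_fin fineK ?fin_num_measure//; last exact: measurable_mball.
rewrite -mE; apply: le_measure; rewrite ?inE//; first exact: measurable_mball.
move=> v [gv /= /eqP wv]; apply: le_lt_trans hl; exact: h.
Qed.

End Coding.

(** * Strips and arcs of the circle *)

Section CircleMeasure.
Context {R : realType}.
Implicit Types (t c r delta : R).

Lemma measurable_dist_int : measurable_fun setT (@dist_int R).
Proof.
apply: measurable_realfun.continuous_measurable_fun => x; apply/cvgrPdist_lt => e e0.
near=> y; have xy : `|x - y| < e by near: y; exact: cvgr_dist_lt.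
apply: le_lt_trans xy; rewrite ler_norml; apply/andP; split.
  have := dist_intD x (y - x); rewrite addrC subrK.
  by have := dist_int_le_norm (y - x); rewrite distrC; lra.
have := dist_intD y (x - y); rewrite addrC subrK.
by have := dist_int_le_norm (x - y); lra.
Unshelve. all: by end_near. Qed.

Lemma circle_measureE (A : set R) : measurable A ->
  circle_measure R A = lebesgue_measure (A `&` `[0, 1]).
Proof.
move=> mA.
have -> : circle_measure R A =
  (\int[lebesgue_measure]_(x in A) (uniform_pdf 0 1 x)%:E)%E by [].
rewrite integral_uniform_pdf.
rewrite (eq_integral (fun=> 1%E)) ?integral_cst ?mul1e//; last first.
  move=> x; rewrite inE => -[_]; rewrite /= in_itv/= /uniform_pdf => ->.
  by rewrite subr0 invr1.
exact: measurableI.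
Qed.

Lemma measurable_strip (a c r : R) :
  measurable [set t | dist_int (a * t + c) < r].
Proof.
have m : measurable_fun setT (fun t : R => dist_int (a * t + c)).
  apply: measurableT_comp; first exact: measurable_dist_int.
  by apply: measurable_funD => //; exact: measurable_funM.
rewrite (_ : mkset _ = (fun t : R => dist_int (a * t + c)) @^-1` `]-oo, r[).
  by rewrite -[_ @^-1` _]setTI; apply: m.
by apply/seteqP; split => t /=; rewrite in_itv.
Qed.

(** Within [[0, 1]] the strip is covered by intervals of radius [delta / q] around the points
    [(z - c) / q]; at most [q + 3] integers [z] occur, and [2 * (q + 3) <= 8 * q]. *)
Lemma circle_measure_strip (q : nat) c delta : (0 < q)%N -> 0 < delta ->
  (circle_measure R [set t | (dist_int (q%:R * t + c) < delta)%R] <=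
   (8 * delta)%:E)%E.
Proof.
move=> q0 d0; have qR : 0 < q%:R :> R by rewrite ltr0n.
have mS := measurable_strip q%:R c delta.
rewrite circle_measureE//.
(* As [q * t >= 0] and the nearest integer is at distance at most 1, no relevant integer lies below
   [c - 1]. *)
pose z0 := Num.floor (c - 1).
pose B (i : nat) : set R := ball ((z0%:~R + i%:R - c) / q%:R) (delta / q%:R).
have mB i : measurable (B i) by exact: measurable_ball.
apply: (@le_trans _ _ (lebesgue_measure (\big[setU/set0]_(i < q + 3) B i))).
  apply: le_measure; rewrite ?inE.
  - exact: measurableI.
  - by apply: bigsetU_measurable => i _; exact: mB.
  move=> t [/= td]; rewrite in_itv/= => /andP[t0 t1].
  have [z hz] := dist_intP (q%:R * t + c).
  have hz1 : `|q%:R * t + c - z%:~R| <= 1 by rewrite -hz dist_int_le1.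
  have := floor_itv (c - 1); rewrite -/z0 intrD => /andP[f1 f2].
  have qt : q%:R * t <= q%:R by rewrite ler_piMr// ltW.
  have qt0 : 0 <= q%:R * t by rewrite mulr_ge0// ltW.
  move: hz1; rewrite ler_norml => /andP[h1 h2].
  have zz0 : z0 <= z by rewrite -(ler_int R); lra.
  have zq : z - z0 < q%:Z + 3 by rewrite -(ltr_int R) intrB intrD -pmulrn; lra.
  have iq : (`|z - z0| < q + 3)%N by lia.
  rewrite (bigD1 (Ordinal iq))//=; left.
  have ei : z0%:~R + `|z - z0|%N%:R = z%:~R :> R.
    by rewrite pmulrn gez0_abs ?subr_ge0// intrB addrC subrK.
  rewrite /B /ball /= ei -(ltr_pM2r qR) divfK ?gt_eqF//.
  rewrite -[X in _ * X](ger0_norm (ltW qR)) -normrM mulrBl divfK ?gt_eqF//.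
  by move: td; rewrite hz distrC; congr (`|_| < _); ring.
apply: le_trans.
  by apply: Boole_inequality => i _; exact: mB.
rewrite (eq_bigr (fun=> (delta / q%:R *+ 2)%:E)); last first.
  by move=> i _; apply: lebesgue_measure_ball; rewrite divr_ge0// ltW.
rewrite sumEFin lee_fin sumr_const card_ord -mulrnA -[leLHS]mulr_natr.
rewrite mulrAC ler_pdivrMr// -mulrA [leRHS]mulrCA ler_pM2l//.
by rewrite -!natrM ler_nat; lia.
Qed.

(** The circle is cut at 0, so a symmetric interval around [t] may leave [[0, 1]]; a one-sided
    interval of length [r] towards the farther end never does. *)
Lemma circle_measure_ball_ge t r : 0 <= t <= 1 -> 0 < r <= 2^-1 ->
  (r%:E <= circle_measure R [set t' | (dist_int (t - t') < r)%R])%E.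
Proof.
move=> /andP[t0 t1] /andP[r0 r1].
have mS : measurable [set t' | dist_int (t - t') < r].
  rewrite (_ : mkset _ = [set t' | dist_int (-1 * t' + t) < r]).
    exact: measurable_strip.
  by apply/seteqP; split => t' /=; rewrite mulN1r addrC.
rewrite circle_measureE//.
have [I [mI EI sI]] : exists I : set R, [/\ measurable I, lebesgue_measure I = r%:E
    & I `<=` [set t' | dist_int (t - t') < r] `&` `[0, 1]].
  have [h|h] := lerP t 2^-1.
    exists `[t, t + r[%classic; split => //.
      rewrite lebesgue_measure_itv/= lte_fin ltrDl r0 -EFinD; congr EFin; ring.
    move=> t' /=; rewrite !in_itv/= => /andP[h1 h2]; split; last first.
      by apply/andP; split; lra.
    by apply: le_lt_trans (dist_int_le_norm _) _; rewrite ltr_norml; apply/andP; split; lra.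
  exists `]t - r, t]%classic; split => //.
    rewrite lebesgue_measure_itv/= lte_fin ltrBlDr ltrDl r0 -EFinD; congr EFin; ring.
  move=> t' /=; rewrite !in_itv/= => /andP[h1 h2]; split; last first.
    by apply/andP; split; lra.
  by apply: le_lt_trans (dist_int_le_norm _) _; rewrite ltr_norml; apply/andP; split; lra.
by rewrite -EI; apply: le_measure => //; rewrite inE//; exact: measurableI.
Qed.

End CircleMeasure.

(** * Null sets, Borel-Cantelli and product measures *)

Section AlmostEverywhere.
Context d (X : measurableType d) (R : realType) (m : {measure set X -> \bar R}).
Implicit Types P Q : X -> Prop.

Lemma ae_and P Q : {ae m, forall x, P x} -> {ae m, forall x, Q x} ->
  {ae m, forall x, P x /\ Q x}.
Proof. by move=> hP hQ; apply: negligibleS (negligibleU hP hQ) => x /= /not_andP. Qed.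

Lemma ae_imply P Q : (forall x, P x -> Q x) -> {ae m, forall x, P x} ->
  {ae m, forall x, Q x}.
Proof. by move=> PQ; apply: negligibleS => x /= nQ /PQ. Qed.

End AlmostEverywhere.

Section BorelCantelli.
Context d (X : measurableType d) (R : realType) (m : {measure set X -> \bar R}).

Lemma borel_cantelli_geometric (E : nat -> set X) (c : R) : 0 <= c ->
  (forall k, measurable (E k)) ->
  (\forall k \near \oo, (m (E k) <= (c / 2 ^+ k)%:E)%E) ->
  {ae m, forall x, \forall k \near \oo, ~ E k x}.
Proof.
move=> c0 mE [N _ hN]; pose F k := E (k + N)%N.
have mF k : measurable (F k) by exact: mE.
have bF k : (m (F k) <= (c / 2 ^+ k)%:E)%E.
  apply: le_trans (hN _ (leq_addl k N)) _; rewrite lee_fin ler_wpM2l//.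
  by rewrite lef_pV2 ?posrE ?exprn_gt0// ler_weXn2l ?ler1n ?leq_addr.
have F0 : m (lim_sup_set F) = 0%E.
  apply: lim_sup_set_cvg0 => //.
  apply: (@le_lt_trans _ _ (c * 2)%:E); last exact: ltry.
  apply: lime_le; first exact: is_cvg_nneseries.
  apply: nearW => n; apply: (@le_trans _ _ (c * (2 - 2 / 2 ^+ n))%:E); last first.
    by rewrite lee_fin ler_wpM2l// gerBl divr_ge0// exprn_ge0.
  elim: n => [|n IH]; first by rewrite big_nil expr0 divr1 subrr mulr0.
  rewrite big_nat_recr//=; apply: le_trans (leeD IH (bF n)) _.
  rewrite -EFinD lee_fin -mulrDr ler_wpM2l// exprS invfM.
  have := exprn_gt0 n (ltr0n R 2); set y := 2 ^+ n => y0.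
  by rewrite mulrA divff// mul1r; lra.
have mlim : measurable (lim_sup_set F).
  apply: bigcap_measurable => // n _; apply: bigcup_measurable => k _; exact: mF.
exists (lim_sup_set F); split=> // x /= nx n _; apply: contrapT => nF; apply: nx.
exists (n + N)%N => // k /= nk Ek; apply: nF; exists (k - N)%N => /=; first lia.
by rewrite /F subnK//; lia.
Qed.

End BorelCantelli.

Section ProductNull.
Context d1 d2 (X : measurableType d1) (Y : measurableType d2) (R : realType).
Variables (m1 : probability X R) (m2 : probability Y R).

Let m1T : (m1 : {measure set X -> \bar R}) setT = 1%E.
Proof. exact: probability_setT. Qed.

Let m2T : (m2 : {measure set Y -> \bar R}) setT = 1%E.
Proof. exact: probability_setT. Qed.

Lemma product_measure_setT : (m1 \x m2)%E setT = 1%E.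
Proof.
by rewrite -setXTT product_measure1E// m1T m2T mul1e.
Qed.

(* The product measure of the library carries no probability structure, nor a
   sigma-finite one, but [nu \x nu] needs [nu] to be sigma-finite. *)
Definition product_prob : probability (X * Y)%type R :=
  HB.pack_for (probability (X * Y)%type R) (m1 \x m2)%E
    (@Measure_isProbability.Build _ _ R (m1 \x m2)%E product_measure_setT).

Lemma product_probX (A : set X) (B : set Y) : measurable A -> measurable B ->
  product_prob (A `*` B) = (m1 A * m2 B)%E.
Proof. exact: product_measure1E. Qed.

Lemma product_measure_le_xsection (A : set (X * Y)) (b : R) : measurable A ->
  0 <= b -> (forall x, (m2 (xsection A x) <= b%:E)%E) -> ((m1 \x m2)%E A <= b%:E)%E.
Proof.
move=> mA b0 h; rewrite /product_measure1.
apply: (@le_trans _ _ (\int[m1]_x b%:E)%E).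
  by apply: ge0_le_integral => //=; exact: measurable_fun_xsection.
by rewrite integral_cst// m1T mule1.
Qed.

(** The product is defined by integrating over the first factor; uniqueness of the product measure
    permits the other order, in which the second coordinate is fixed. *)
Lemma product_prob_le_ysection (A : set (X * Y)) (b : R) : measurable A ->
  0 <= b -> (forall y, (m1 (ysection A y) <= b%:E)%E) -> (product_prob A <= b%:E)%E.
Proof.
move=> mA b0 h; rewrite -[product_prob A]/((m1 \x m2)%E A).
rewrite (@product_measure_unique _ _ _ _ _ m1 m2 (m1 \x^ m2)%E)//.
  rewrite /= /product_measure2.
  apply: (@le_trans _ _ (\int[m2]_x b%:E)%E).
    by apply: ge0_le_integral => //=; exact: measurable_fun_ysection.
  by rewrite integral_cst// m2T mule1.
by move=> B C mB mC; rewrite /= product_measure2E.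
Qed.

Lemma negligible_fst (A : set X) : m1.-negligible A ->
  (m1 \x m2)%E.-negligible (fst @^-1` A).
Proof.
move=> [N [mN N0 AN]]; exists (N `*` setT); split; first exact: measurableX.
  have {}N0 : (m1 : {measure set X -> \bar R}) N = 0%E := N0.
  by rewrite product_measure1E// N0 mul0e.
by move=> x /AN.
Qed.

Lemma negligible_snd (A : set Y) : m2.-negligible A ->
  (m1 \x m2)%E.-negligible (snd @^-1` A).
Proof.
move=> [N [mN N0 AN]]; exists (setT `*` N); split; first exact: measurableX.
  have {}N0 : (m2 : {measure set Y -> \bar R}) N = 0%E := N0.
  by rewrite product_measure1E// N0 mule0.
by move=> x /AN.
Qed.

End ProductNull.

(** * Lower limits of extended real sequences *)

Section LimInf.
Context {R : realType}.
Implicit Types (u : (\bar R)^nat) (c : \bar R).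

Lemma limn_einfE u : limn_einf u = ereal_sup (range (einfs u)).
Proof.
rewrite limn_einf_lim; apply/cvg_lim => //; exact: cvg_einfs_sup.
Qed.

Lemma limn_einf_ge u c : (\forall n \near \oo, (c <= u n)%E) ->
  (c <= limn_einf u)%E.
Proof.
move=> [N _ h]; rewrite limn_einfE; apply: (@le_trans _ _ (einfs u N)).
  by apply: le_ereal_inf_tmp => _ [n /= Nn <-]; exact: h.
by apply: ereal_sup_ubound; exists N.
Qed.

Lemma limn_einf_le u c : (forall N, exists2 n, (N <= n)%N & (u n <= c)%E) ->
  (limn_einf u <= c)%E.
Proof.
move=> h; rewrite limn_einfE; apply: ge_ereal_sup => _ [N _ <-].
have [n Nn un] := h N; apply: le_trans un; apply: ereal_inf_lbound.
by exists n.
Qed.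

End LimInf.

(** * Orbits of the skew product *)

Section SkewProduct.
Context {R : realType} {Om : pmetricType R}.
Variables (T : Om -> Om) (I : set Om) (alpha : R).
Local Notation S := (skew_product T (\1_I : Om -> R) alpha).
Implicit Types (x y : borel Om * measurableTypeR R).

Definition visits (i : nat) (w : Om) : nat :=
  \sum_(k < i) (iter k T w \in I).

Lemma visits_le i w : (visits i w <= i)%N.
Proof.
rewrite -[leqRHS]muln1 -[X in (X * 1)%N]card_ord -sum_nat_const.
by apply: leq_sum => k _; exact: leq_b1.
Qed.

Lemma skew_iter1 i x : (iter i S x).1 = iter i T x.1.
Proof. by elim: i => //= i ->. Qed.

Lemma skew_iter2 i x : exists z : int,
  (iter i S x).2 = x.2 + (visits i x.1)%:R * alpha + z%:~R :> R.
Proof.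
elim: i => [|i [z IH]].
  by exists 0; rewrite /visits big_ord0 mul0r !addr0.
rewrite /= {1}/skew_product /= skew_iter1 IH /Defs.frac.
set f := Num.floor _; exists (z - f).
rewrite /visits big_ord_recr/= natrD intrB indicE; ring.
Qed.

(** The integers produced by the reductions modulo 1 disappear by periodicity; what remains of the
    skew product is the difference of the two visit counts. *)
Lemma dist_M_skew i j x y : dist_M (iter i S x) (iter j S y) =
  Num.max (mdist (iter i T x.1 : Om) (iter j T y.1 : Om))
    (dist_int ((x.2 : R) - y.2 + ((visits i x.1)%:Z - (visits j y.1)%:Z)%:~R * alpha)).
Proof.
rewrite /dist_M !skew_iter1; congr Num.max.
have [z ->] := skew_iter2 i x; have [z' ->] := skew_iter2 j y.
rewrite intrB -!pmulrn -(dist_intDz _ (z' - z)) intrB; congr dist_int; ring.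
Qed.

Lemma shortest_distance_le n i j x y : (i < n)%N -> (j < n)%N ->
  (shortest_distance S n x y <= (dist_M (iter i S x) (iter j S y))%:E)%E.
Proof.
move=> ni nj; rewrite /shortest_distance.
by rewrite (bigD1 (Ordinal ni))//= (bigD1 (Ordinal nj))//= !ge_min lexx.
Qed.

Lemma shortest_distance_ge n x y (r : R) :
  (forall i j, (i < n)%N -> (j < n)%N -> r <= dist_M (iter i S x) (iter j S y)) ->
  (r%:E <= shortest_distance S n x y)%E.
Proof.
move=> h; rewrite /shortest_distance.
elim/big_ind: _ => [|a b ha hb|i _]; first exact: leey.
  by rewrite le_min ha hb.
elim/big_ind: _ => [|a b ha hb|j _]; first exact: leey.
  by rewrite le_min ha hb.
by rewrite lee_fin h.
Qed.

End SkewProduct.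

(** * Growth estimates, irrationality exponent and logarithmic ratios *)

Section Growth.
Context {R : realType}.
Implicit Types (x rho c : R).

Lemma nat_powR_ge (delta A : R) : 0 < delta ->
  \forall q \near \oo, A <= (q%:R : R) `^ delta.
Proof.
move=> d0; exists (Num.truncn (`|A| `^ delta^-1)).+1 => // q /= qN.
have h : `|A| `^ delta^-1 <= q%:R.
  apply: ltW; apply: lt_le_trans (truncnS_gt _) _; by rewrite ler_nat.
apply: le_trans (ler_norm A) _.
have -> : `|A| = (`|A| `^ delta^-1) `^ delta.
  by rewrite -powRrM mulVf ?gt_eqF// powRr1.
by apply: ge0_ler_powR; rewrite ?nnegrE ?powR_ge0// ltW.
Qed.

Lemma bernoulli_ineq rho n : 0 <= rho -> 1 + n%:R * rho <= (1 + rho) ^+ n.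
Proof.
move=> r0; elim: n => [|n IH]; first by rewrite mul0r addr0 expr0.
rewrite exprS; apply: (@le_trans _ _ ((1 + rho) * (1 + n%:R * rho))).
  have : 0 <= rho * (n%:R * rho) by rewrite !mulr_ge0.
  by rewrite -natr1; nra.
by apply: ler_wpM2l => //; lra.
Qed.

(** Bernoulli's inequality for the square root of [rho], squared, gives quadratic growth, of which
    one factor beats [c] and the other [k + 1]. *)
Lemma expr_dominates rho c : 1 < rho ->
  \forall k \near \oo, c * k.+1%:R <= rho ^+ k.
Proof.
move=> r1; pose h := Num.sqrt rho - 1.
have r0 : 0 < rho by exact: lt_trans r1.
have h0 : 0 < h by rewrite subr_gt0 -[ltLHS]sqrtr1 ltr_sqrt.
have e : rho = (1 + h) * (1 + h).
  by rewrite /h addrC subrK -expr2 sqr_sqrtr// ltW.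
pose m := Num.min 1 h.
have m0 : 0 < m by rewrite lt_min ltr01 h0.
exists (Num.truncn (`|c| / m / h)).+1 => // k /= hk.
have h1 : m * k.+1%:R <= 1 + k%:R * h.
  have m1 : m <= 1 by rewrite ge_min lexx.
  have mh : m <= h by rewrite ge_min lexx orbT.
  have k0 : 0 <= k%:R :> R by [].
  by rewrite -natr1; nra.
have h2 : `|c| / m <= 1 + k%:R * h.
  have : `|c| / m / h < k%:R.
    by apply: lt_le_trans (truncnS_gt _) _; rewrite ler_nat.
  by rewrite ltr_pdivrMr// => /ltW h2; rewrite (le_trans h2)// lerDr.
rewrite e exprMn.
apply: (@le_trans _ _ ((1 + k%:R * h) * (1 + k%:R * h))); last first.
  have b := bernoulli_ineq k (ltW h0).
  by apply: ler_pM => //; rewrite addr_ge0// mulr_ge0// ltW.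
apply: (@le_trans _ _ (`|c| / m * (m * k.+1%:R))).
  rewrite mulrA divfK ?gt_eqF//; apply: ler_wpM2r => //; exact: ler_norm.
apply: ler_pM => //; first by rewrite divr_ge0// ltW.
by rewrite mulr_ge0// ltW.
Qed.

End Growth.

Section IrrationalityExponent.
Context {R : realType}.
Variable alpha : R.

(** If the product stayed above [e] from [N] on, [b] would belong to the set whose infimum is the
    exponent. *)
Lemma irrationality_exponent_gt b : (b%:E < irrationality_exponent alpha)%E ->
  forall e N, 0 < e -> exists2 q : nat, (N <= q)%N &
    q%:R `^ b * dist_int (q%:R * alpha) < e.
Proof.
move=> hb e N e0; apply: contrapT => h.
have : (irrationality_exponent alpha <= b%:E)%E.
  apply: ereal_inf_lbound; exists b => //=.
  apply: (@lt_le_trans _ _ e%:E); first by rewrite lte_fin.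
  apply: limn_einf_ge; exists N => // q /= Nq; rewrite lee_fin leNgt.
  by apply/negP => hq; apply: h; exists q.
by rewrite leNgt hb.
Qed.

(** Some [a < b] in the defining set bounds the product below for large [q]; for the finitely many
    others, irrationality makes it positive. *)
Lemma irrationality_exponent_lt b : irrational alpha ->
  (irrationality_exponent alpha < b%:E)%E ->
  exists2 c : R, 0 < c & forall q : nat, (0 < q)%N ->
    c <= q%:R `^ b * dist_int (q%:R * alpha).
Proof.
move=> ia /ereal_inf_lt[_ [a /= a0 <-]]; rewrite lte_fin => ab.
pose f (q : nat) := q%:R `^ b * dist_int (q%:R * alpha).
have fpos (q : nat) : (0 < q)%N -> 0 < f q.
  move=> q0; rewrite mulr_gt0 ?powR_gt0 ?ltr0n// lt_def dist_int_ge0 andbT.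
  apply/eqP => /dist_int_eq0[z hz]; apply: ia.
  apply/rationalP; exists z, q.
  by rewrite -hz mulrC mulKf// pnatr_eq0 -lt0n.
have [e e0 [N hN]] : exists2 e : R, 0 < e & exists N, forall q, (N <= q)%N ->
    e <= q%:R `^ a * dist_int (q%:R * alpha).
  apply: contrapT => h.
  suff : (limn_einf (fun q : nat => (q%:R `^ a * dist_int (q%:R * alpha))%:E) <= 0)%E.
    by rewrite leNgt a0.
  apply/lee_addgt0Pr => e e0; rewrite add0e; apply: limn_einf_le => N.
  apply: contrapT => h'; apply: h; exists e => //; exists N => q Nq.
  rewrite leNgt; apply/negP => hq; apply: h'; exists q => //.
  by rewrite lee_fin ltW.
have [c1 c10 hc1] : exists2 c : R, 0 < c & forall q, (0 < q < N)%N -> c <= f q.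
  elim: N {hN} => [|N [c c0 hc]]; first by exists 1 => // q; rewrite ltn0 andbF.
  have [->|N0] := posnP N; first by exists 1 => // q; case: q.
  exists (Num.min c (f N)); first by rewrite lt_min c0 fpos.
  move=> q /andP[q0]; rewrite ltnS leq_eqVlt ge_min => /orP[/eqP ->|qN].
    by rewrite lexx orbT.
  by rewrite hc// q0.
exists (Num.min e c1); first by rewrite lt_min e0 c10.
move=> q q0; rewrite ge_min; have [qN|Nq] := ltnP q N.
  by rewrite [X in _ || X]hc1 ?orbT// q0.
apply/orP; left; apply: le_trans (hN q Nq) _.
apply: ler_wpM2r; first exact: dist_int_ge0.
by apply: ler_powR; [rewrite ler1n|exact: ltW].
Qed.

End IrrationalityExponent.

Section LogRatio.
Context {R : realType}.
Variables (n : nat) (c : R) (m : \bar R).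
Hypothesis n2 : (2 <= n)%N.

Let lnn : 0 < ln (n%:R : R).
Proof. by apply: ln_gt0; rewrite ltr1n. Qed.

Lemma log_ratio_le : (((n%:R `^ c)^-1)%:E <= m)%E -> (m < +oo)%E ->
  (lne m / (- ln n%:R)%:E <= c%:E)%E.
Proof.
have nc : 0 < (n%:R `^ c)^-1 :> R by rewrite invr_gt0 powR_gt0// ltr0n; lia.
case: m => [r| |]//; rewrite lee_fin => hr _.
have r0 : 0 < r := lt_le_trans nc hr.
rewrite lne_EFin// inver oppr_eq0 gt_eqF// -EFinM lee_fin invrN mulrN -mulNr.
rewrite ler_pdivrMr// -ln_powR lerNl -lnV ?posrE ?powR_gt0 ?ltr0n//; last lia.
by rewrite ler_ln ?posrE.
Qed.

Lemma log_ratio_ge : (0 <= m)%E -> (m <= ((n%:R `^ c)^-1)%:E)%E ->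
  (c%:E <= lne m / (- ln n%:R)%:E)%E.
Proof.
have nc : 0 < (n%:R `^ c)^-1 :> R by rewrite invr_gt0 powR_gt0// ltr0n; lia.
case: m => [r| |]//; rewrite !lee_fin => r0 hr.
rewrite inver oppr_eq0 gt_eqF//.
(* At distance 0 the logarithm is [-oo], and dividing by [- ln n < 0] gives [+oo]. *)
move: r0; rewrite le_eqVlt => /orP[/eqP <-|r0].
  by rewrite le0_lneNy//= lt0_mulNye ?leey// lte_fin invrN oppr_lt0 invr_gt0.
rewrite lne_EFin// -EFinM lee_fin invrN mulrN -mulNr.
rewrite ler_pdivlMr// -ln_powR lerNr -lnV ?posrE ?powR_gt0 ?ltr0n//; last lia.
by rewrite ler_ln ?posrE.
Qed.

End LogRatio.

(** * Upper bound for the lower limit *)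

Section UpperHalf.
Context {R : realType} {Om : pmetricType R}.
Variables (mu : probability (borel Om) R).
Local Notation lam := (circle_measure R).
Local Notation nu := (product_prob mu lam).
Local Notation X := (borel Om * measurableTypeR R)%type.

Lemma measurable_circle_coord (c : R) (q : R) r :
  measurable [set xy : X * X |
    dist_int (q * ((xy.2.2 : R) - (xy.1.2 : R)) + c) < r].
Proof.
have m : measurable_fun setT (fun xy : X * X => dist_int (q * ((xy.2.2 : R) - (xy.1.2 : R)) + c)).
  apply: (measurableT_comp measurable_dist_int).
  apply: measurable_funD => //; apply: measurable_funM => //.
  apply: measurable_funB; apply: measurableT_comp => //.
rewrite (_ : mkset _ = (fun xy : X * X => dist_int (q * ((xy.2.2 : R) - (xy.1.2 : R)) + c))
    @^-1` `]-oo, r[).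
  by rewrite -[_ @^-1` _]setTI; apply: m.
by apply/seteqP; split => t /=; rewrite in_itv.
Qed.

Lemma measure_strip_le (q : nat) (c delta : R) : (0 < q)%N -> 0 < delta ->
  ((nu \x nu)%E [set xy : X * X |
    (dist_int (q%:R * ((xy.2.2 : R) - (xy.1.2 : R)) + c) < delta)%R] <=
   (8 * delta)%:E)%E.
Proof.
move=> q0 d0; apply: product_measure_le_xsection.
- exact: measurable_circle_coord.
- by rewrite mulr_ge0// ltW.
move=> x.
rewrite (_ : xsection _ x = setT `*`
    [set t | dist_int (q%:R * t + (c - q%:R * (x.2 : R))) < delta]); last first.
  apply/seteqP; split => y /=; rewrite /xsection/= inE/=.
    move=> h; split => //; move: h; congr (dist_int _ < _); ring.
  by move=> [_ h]; move: h; congr (dist_int _ < _); ring.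
rewrite product_probX//; last exact: measurable_strip.
by rewrite probability_setT mul1e; exact: circle_measure_strip.
Qed.

Variables (T : Om -> Om) (I : set Om) (alpha : R).
Local Notation S := (skew_product T (\1_I : Om -> R) alpha).

(* The circle coordinates of the two orbits differ by [x.2 - y.2 + m * alpha]
   with [`|m| <= q ^ b], and [q * alpha] is so close to an integer that
   multiplication by [q] almost removes the term [m * alpha]. *)
Lemma shortest_distance_ge_strip (q : nat) (b c e : R) (x y : X) :
  (0 < q)%N -> 0 < c -> 0 < e ->
  q%:R `^ b * dist_int (q%:R * alpha) < e ->
  e^-1 * q%:R <= (q%:R `^ b / 2) `^ c ->
  2 <= q%:R `^ b ->
  2 * e <= dist_int (q%:R * ((y.2 : R) - (x.2 : R))) ->
  let n := Num.truncn (q%:R `^ b) in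
  q%:R `^ b / 2 <= n%:R /\
  (((n%:R `^ c)^-1)%:E <= shortest_distance S n x y)%E.
Proof.
move=> q0 c0 e0 hq hc z2 hxy n; set z := q%:R `^ b in hq hc z2 n *.
have qR : 0 < q%:R :> R by rewrite ltr0n.
have /andP[nz1 nz2] : n%:R <= z < n.+1%:R by apply: truncn_itv; lra.
have zn : z / 2 <= n%:R by move: nz2; rewrite -natr1; lra.
(* [hc] and [q ^ b / 2 <= n] give [q / e <= n ^ c]. *)
split => //; apply: (@le_trans _ _ (e / q%:R)%:E).
  rewrite lee_fin -[leRHS]invrK invf_div lef_pV2 ?posrE ?divr_gt0//; last first.
    by rewrite powR_gt0//; lra.
  rewrite mulrC; apply: le_trans hc _.
  by apply: ge0_ler_powR; rewrite ?nnegrE ?ltW//; lra.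
apply: shortest_distance_ge => i j ni nj; rewrite dist_M_skew le_max; apply/orP; right.
set m : int := _ - _.
have mz : `|m|%:~R <= z :> R.
  apply: le_trans nz1; rewrite [leRHS]pmulrn ler_int /m.
  have := visits_le T I i x.1; have := visits_le T I j y.1; lia.
rewrite ler_pdivrMr// mulrC; apply: le_trans (dist_intMn q _).
set s := (x.2 : R) - y.2.
have -> : q%:R * (s + m%:~R * alpha) = q%:R * s + m%:~R * (q%:R * alpha) by ring.
have h1 : 2 * e <= dist_int (q%:R * s).
  by rewrite -dist_intN -mulrN /s opprB.
have h2 : dist_int (m%:~R * (q%:R * alpha)) <= e.
  apply: le_trans (dist_intMz _ _) _; apply: le_trans (ltW hq).
  by apply: ler_wpM2r => //; exact: dist_int_ge0.
have := dist_intD (q%:R * s + m%:~R * (q%:R * alpha)) (- (m%:~R * (q%:R * alpha))).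
rewrite addrK dist_intN; lra.
Qed.

(** The tolerance [2 ^ - j] at the [j]-th chosen [q] is summable, and [1 < b * c] leaves room to
    absorb it, since [q ^ (b * c - 1)] is unbounded. The last requirement on [q] sends the times to
    infinity. *)
Lemma liminf_shortest_distance_le (b c : R) : 0 < b -> 0 < c -> 1 < b * c ->
  (b%:E < irrationality_exponent alpha)%E ->
  {ae (nu \x nu)%E, forall xy, (limn_einf (fun k : nat =>
      lne (shortest_distance S k xy.1 xy.2) / (- ln k%:R)%:E) <= c%:E)%E}.
Proof.
move=> b0 c0 bc hb.
have /choice[f fP] : forall j, exists q : nat,
    [/\ (0 < q)%N, q%:R `^ b * dist_int (q%:R * alpha) < 2^-1 ^+ j,
        (2^-1 ^+ j)^-1 * q%:R <= (q%:R `^ b / 2) `^ c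
      & 2 * (j + 2)%:R <= (q%:R : R) `^ b].
  move=> j.
  have bc1 : 0 < b * c - 1 by rewrite subr_gt0.
  have [N1 _ h1] := nat_powR_ge ((2^-1 ^+ j)^-1 * 2 `^ c) bc1.
  have [N2 _ h2] := nat_powR_ge (2 * (j + 2)%:R) b0.
  have e0 : 0 < 2^-1 ^+ j :> R by rewrite exprn_gt0 ?invr_gt0.
  have [q qN hq] := irrationality_exponent_gt hb (maxn 1 (maxn N1 N2)) e0.
  have q0 : (0 < q)%N by lia.
  have qR : 0 < q%:R :> R by rewrite ltr0n.
  exists q; split => //; last by apply: h2 => /=; lia.
  rewrite powRM ?powR_ge0// -[2^-1 `^ c]/((2^-1 : R) `^ c) -[2^-1 in leRHS]powR_inv1//.
  rewrite -!powRrM mulN1r powRN ler_pdivlMr ?powR_gt0//.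
  have -> : (q%:R : R) `^ (b * c) = q%:R `^ (b * c - 1) * q%:R.
    by rewrite -{3}(powRr1 (ltW qR)) -powRD ?subrK//; apply/implyP => _; rewrite gt_eqF.
  by rewrite mulrAC ler_pM2r//; apply: h1 => /=; lia.
pose E j := [set xy : X * X |
  dist_int ((f j)%:R * ((xy.2.2 : R) - (xy.1.2 : R)) + 0) < 2 * 2^-1 ^+ j].
(* 16 is the strip constant 8 times the factor 2 in the width of [E j]. *)
have := @borel_cantelli_geometric _ _ _ (nu \x nu)%E E 16 _ _ _.
case => //.
- by move=> j; exact: measurable_circle_coord.
- apply: nearW => j; have [q0 _ _ _] := fP j.
  apply: le_trans (measure_strip_le 0 q0 _) _.
    by rewrite mulr_gt0// exprn_gt0// invr_gt0.
  by rewrite lee_fin exprVn mulrA; lra.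
move=> A hA; exists A; case: hA => mA A0 hA; split => //.
apply: subset_trans hA => -[x y] /= nle Enear; apply: nle.
have [J _ hJ] := Enear.
apply: limn_einf_le => N; pose j := maxn N J.
have [q0 h1 h2 h3] := fP j.
have e0 : 0 < 2^-1 ^+ j :> R by rewrite exprn_gt0 ?invr_gt0.
have := hJ j (leq_maxr _ _); rewrite /E /= addr0 => /negP; rewrite -leNgt => h4.
have z2 : 2 <= ((f j)%:R : R) `^ b.
  apply: le_trans h3; rewrite natrD; have : 0 <= j%:R :> R by []. by lra.
have [zn hM] := shortest_distance_ge_strip q0 c0 e0 h1 h2 z2 h4.
set n := Num.truncn _ in zn hM.
have nj : (j + 2 <= n)%N by rewrite -(ler_nat R); lra.
have n2 : (2 <= n)%N by exact: leq_trans (leq_addl j 2) nj.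
exists n; first exact: leq_trans (leq_trans (leq_maxl N J) (leq_addr 2 j)) nj.
apply: log_ratio_le => //.
have n0 : (0 < n)%N by exact: ltnW.
by apply: le_lt_trans (shortest_distance_le T I alpha x y n0 n0) _; exact: ltry.
Qed.

End UpperHalf.

(** * Probability that all returns miss the target *)

Section MissedReturns.
Context {R : realType} {Om : pmetricType R} {p : nat}.
Variables (J : 'I_p -> set Om) (T : Om -> Om) (mu : probability (borel Om) R).
Hypothesis Jcover : forall w, exists i, J i w.
Hypothesis Jclosed : forall i, closed (J i).
Hypothesis Tinv : invariant_measure mu T.
Hypothesis bern : bernoulli_measure J T mu.
Variables (A : set 'I_p) (alpha : R).

Local Notation symbol := (symbol Jcover).
Local Notation word := (word T Jcover).
Local Notation generic := (generic J T).
Local Notation weight := (fun i => fine (mu (J i))).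
Local Notation near := (near_words T Jcover).
Local Notation lam := (circle_measure R).
Local Notation nu := (product_prob mu lam).
Local Notation X := (borel Om * measurableTypeR R)%type.
Local Notation I := (\bigcup_(i in A) J i).
Let a : pred 'I_p := fun i => `[< A i >].

Let weight_ge0 i : 0 <= weight i.
Proof. by have [h _ _] := bern; exact: ltW. Qed.

Let weight_sum : \sum_i weight i = 1.
Proof. by have [_ h _] := bern. Qed.

Lemma visits_word i w : generic w -> visits T I i w = count a (word i w).
Proof.
move=> gw; elim: i => [|i IH]; first by rewrite /visits big_ord0.
have -> : word i.+1 w = rcons (word i w) (symbol (iter i T w)) by exact: mkseqS.
rewrite /visits big_ord_recr -/(visits T I i w) IH -cats1 count_cat/= addn0.
congr (_ + nat_of_bool _)%N; apply/idP/idP.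
  rewrite inE => -[j Aj Jj]; apply/asboolP.
  by rewrite -(generic_symbol Jcover gw Jj).
by move=> /asboolP As; rewrite inE; exists (symbol (iter i T w)) => //; exact: symbolP.
Qed.

(* [xy.2] starts the moving orbit, [xy.1] is its target. *)
Definition missed (l n : nat) (r e k0 : R) : set (X * X) := [set xy |
  [/\ generic xy.1.1, generic xy.2.1,
      k0 <= prob weight l (near l r (word l xy.1.1))
    & forall i, (i + l <= n)%N ->
      near l r (word l xy.1.1) (word l (iter i T xy.2.1)) ->
      e <= dist_int ((xy.2.2 : R) - xy.1.2 + (count a (word i xy.2.1))%:R * alpha)]].

(** For generic points the event depends on two finite words and on the circle coordinates, so it is
    a countable union of products of word sets, cut by complements of strips. *)
Lemma measurable_missed l n r e k0 : measurable (missed l n r e k0).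
Proof.
pose strip c := [set xy : X * X |
  dist_int (1 * ((xy.2.2 : R) - (xy.1.2 : R)) + c) < e].
pose F (uv : seq 'I_p * seq 'I_p) : set (X * X) :=
  if k0 <= prob weight l (near l r uv.1) then
    ((word_in T Jcover l (pred1 uv.1) `*` setT) `*`
     (word_in T Jcover n (pred1 uv.2) `*` setT)) `&`
    \bigcap_(i in [set i | (i + l <= n)%N && near l r uv.1 (take l (drop i uv.2))])
      ~` strip ((count a (take i uv.2))%:R * alpha)
  else set0.
have mw m P : measurable (word_in T Jcover m P).
  exact: (measurable_word_in Jcover Jclosed Tinv bern).
have -> : missed l n r e k0 = \bigcup_uv F uv.
  apply/seteqP; split => -[x y] /=.
    move=> [gx gy kx h]; exists (word l x.1, word n y.1) => //.
    rewrite /F /= kx; split; first by split => //=; split => //; split => //=.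
    move=> i /= /andP[iln]; rewrite subword// => /(h i iln) hi.
    rewrite /strip /= mul1r take_word; last by apply: leq_trans iln; exact: leq_addr.
    by apply/negP; rewrite -leNgt.
  move=> [[u v] _]; rewrite /F /=; case: ifP => // ku.
  move=> [[[/= [gx /eqP xu] _] [[/= gy /eqP yv] _]] h]; split => //=; rewrite xu// => i iln.
  rewrite -(subword T Jcover _ iln) yv => near_i.
  have := h i; rewrite /= iln near_i => /(_ isT) /negP; rewrite -leNgt mul1r -yv take_word//.
  by apply: leq_trans iln; exact: leq_addr.
apply: countable_bigcupT_measurable => //= uv; rewrite /F; case: ifP => // _.
apply: measurableI; first by apply: measurableX; apply: measurableX.
apply: bigcap_measurableType => i _; apply: measurableC; exact: measurable_circle_coord.
Qed.

(** The target and the circle coordinate of the moving point are frozen by Fubini, so that the list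
    [ms] for [s = t' - t] is fixed before any symbol is drawn. A missed word then fails every trial
    or has fewer than [Y] visits, whence the two summands. *)
Lemma measure_missed_le l n Y K r e k0 : (0 < l)%N -> 0 <= k0 <= 1 ->
  (forall s : R, exists ms : seq nat,
    [/\ gapped l ms, {in ms, forall m, m + l <= Y}%N,
        {in ms, forall m, dist_int (s + m%:R * alpha) < e} & (K <= size ms)%N]) ->
  ((nu \x nu)%E (missed l n r e k0) <=
    ((1 - k0) ^+ K + 2 ^+ Y * (1 - (\sum_(i | a i) weight i) / 2) ^+ n)%:E)%E.
Proof.
move=> l0 /andP[k00 k01] hms.
have w1 : 0 <= 1 - (\sum_(i | a i) weight i) / 2.
  have : \sum_(i | a i) weight i <= \sum_i weight i.
    by rewrite [leRHS](bigID a)/= lerDl sumr_ge0.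
  by rewrite weight_sum; lra.
have b0 : 0 <= (1 - k0) ^+ K + 2 ^+ Y * (1 - (\sum_(i | a i) weight i) / 2) ^+ n.
  by rewrite addr_ge0 ?mulr_ge0 ?exprn_ge0// subr_ge0.
have mm := measurable_missed l n r e k0.
apply: product_measure_le_xsection => // -[w t].
apply: (product_prob_le_ysection) => //; first exact: measurable_xsection.
move=> t'; set B := ysection _ _.
have mB : measurable B by apply: measurable_ysection; exact: measurable_xsection.
have BE w' : B w' <-> missed l n r e k0 ((w, t), (w', t')).
  by rewrite /B; split => [/ysectionP/xsectionP//|h]; apply/ysectionP/xsectionP.
have [kw|kw] := boolP (k0 <= prob weight l (near l r (word l w))); last first.
  rewrite (_ : B = set0) ?measure0 ?lee_fin// -subset0 => w' /BE[_ _ h _].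
  by rewrite h in kw.
have [ms [gms msY hdist Kms]] := hms ((t' : R) - t).
pose P := predU (fun u => nohit a l (near l r (word l w)) 0 ms u && (Y <= 0 + count a u)%N)
  (fun u => count a u < Y)%N.
have BP : B `<=` word_in T Jcover n P.
  move=> w' /BE[/= gw gw' _ h]; split => //=.
  have [//|Yc] := ltnP (count a (word n w')) Y; first by rewrite orbT.
  rewrite andbT orbF; apply/nohitP => m i mms; rewrite size_word ?add0n => ni e1.
  apply/negP => near_i.
  (* A window truncated by the end of the word is shorter than [l], hence near to no word. *)
  have iln : (i + l <= n)%N.
    move/asboolP: near_i => [z [z' [_ _ _ /(congr1 size)]]].
    by rewrite size_word size_take_min size_drop size_word; clear -ni; lia.
  have := h i iln; rewrite -(subword T Jcover _ iln) => /(_ near_i).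
  rewrite -[word i w'](take_word T Jcover _ ni) e1 leNgt.
  by rewrite hdist.
apply: (@le_trans _ _ (mu (word_in T Jcover n P))).
  apply: le_measure; rewrite ?inE//.
  exact: (measurable_word_in Jcover Jclosed Tinv bern).
rewrite (measure_word_in Jcover Jclosed Tinv bern) lee_fin.
apply: le_trans (prob_or weight_ge0 _ _ _) _; apply: lerD.
  have c0 : all (leq 0) ms by apply/allP.
  apply: le_trans (prob_nohit weight_ge0 weight_sum _ _ _ l0 gms c0 msY) _.
  have k1 := prob_le1 weight_ge0 weight_sum l (near l r (word l w)).
  apply: (@le_trans _ _ ((1 - k0) ^+ size ms)).
    by apply: lerXn2r; rewrite ?nnegrE; lra.
  by apply: ler_wiXn2l => //; lra.
exact: (prob_count_lt weight_ge0 weight_sum).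
Qed.

End MissedReturns.

(** * Mass of small balls at dyadic radii *)

Section PointwiseDimension.
Context {R : realType} {Om : pmetricType R}.
Variables (mu : probability (borel Om) R).

(** Multiplying by [ln r < 0] reverses the comparison. Positive masses are required since
    [ln 0 = 0]: the limit alone does not exclude null balls. *)
Lemma eventually_measure_mball_ge (w : Om) (d d' : R) :
  (forall r, 0 < r -> 0 < fine (mu [set v | mdist w v < r])) -> d < d' ->
  ln (fine (mu [set v | mdist w v < r])) / ln r @[r --> 0^'+] --> d ->
  \forall r \near 0^'+, r `^ d' <= fine (mu [set v | mdist w v < r]).
Proof.
move=> mpos dd' /cvgrPdist_lt /(_ (d' - d)); rewrite subr_gt0 => /(_ dd') h.
near=> r.
have r0 : 0 < r by near: r; exact: nbhs_right_gt.
have r1 : r < 1 by near: r; exact: nbhs_right_lt.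
have lr : ln r < 0 by apply: ln_lt0; rewrite r0 r1.
have : `|d - ln (fine (mu [set v | mdist w v < r])) / ln r| < d' - d by near: r; exact: h.
rewrite ltr_norml => /andP[h1 _].
have : ln (fine (mu [set v | mdist w v < r])) / ln r < d' by lra.
rewrite ltr_ndivrMr// -ln_powR => h2.
by rewrite -ler_ln ?posrE ?powR_gt0 ?mpos// ltW.
Unshelve. all: by end_near. Qed.

Lemma near_right_pow2 (P : R -> Prop) : (\forall r \near 0^'+, P r) ->
  \forall k \near \oo, P (2 ^- k).
Proof.
move=> /nbhs_ballP[e /= e0 he].
have /cvgrPdist_lt/(_ e e0)[N _ hN] : (2^-1 : R) ^+ k @[k --> \oo] --> (0 : R).
  by apply: cvg_expr; rewrite ger0_norm ?invr_ge0// invf_lt1// ltr1n.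
exists N => // k /hN hk; apply: he; last by rewrite invr_gt0 exprn_gt0.
by move: hk; rewrite exprVn.
Qed.

End PointwiseDimension.

(** * Numerical estimates at scale [2 ^ - k] *)

Section Numerics.
Context {R : realType}.

(** The bounds are [1 - x <= e ^ - x] and [2 <= e]. *)
Lemma expr_onem_le (x : R) (K k : nat) : 0 <= x <= 1 -> k%:R <= x * K%:R ->
  (1 - x) ^+ K <= 2 ^- k.
Proof.
move=> /andP[x0 x1] h.
have h1 : 1 - x <= expR (- x) by exact: expR_ge1Dx.
apply: (@le_trans _ _ (expR (- x) ^+ K)).
  by apply: lerXn2r; rewrite ?nnegrE ?expR_ge0// subr_ge0.
rewrite -expRM_natr mulNr expRN lef_pV2 ?posrE ?expR_gt0 ?exprn_gt0//.
apply: (@le_trans _ _ (expR k%:R)); last by rewrite ler_expR.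
rewrite -[k%:R]mul1r expRM_natr; apply: lerXn2r; rewrite ?nnegrE ?expR_ge0//.
by have := @expR_ge1Dx R 1.
Qed.

(** Passage from scales to all times: each large [n] lies in some [[H ^ k, H ^ (k + 1))], where
    [n ^ - c] is at least [h ^ - (k + 1)] for [h = H ^ c < 2], and [(2 / h) ^ k] absorbs the
    constants. *)
Lemma eventually_power_bound (H c C2 : R) (m : nat -> \bar R) :
  1 < H -> 0 < c -> H `^ c < 2 ->
  (\forall k \near \oo, forall n : nat, H ^+ k <= n%:R -> (m n <= (C2 / 2 ^+ k)%:E)%E) ->
  \forall n \near \oo, (m n <= ((n%:R `^ c)^-1)%:E)%E.
Proof.
move=> H1 c0 Hc2 [k1 _ hk1]; pose h := H `^ c.
have h0 : 0 < h by rewrite powR_gt0//; lra.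
have [k2 _ hk2] : \forall k \near \oo, (C2 * h) * k.+1%:R <= (2 / h) ^+ k.
  by apply: expr_dominates; rewrite ltr_pdivlMr// mul1r.
pose k0 := maxn k1 k2.
have H0 : 0 < H by lra.
exists (Num.truncn (H ^+ k0)).+1 => // n /= hn.
have nH : H ^+ k0 <= n%:R.
  by apply: ltW; apply: lt_le_trans (truncnS_gt _) _; rewrite ler_nat.
have [j hj] : exists j, n%:R < H ^+ j.
  have [N _ /(_ N (leqnn _)) hN] := expr_dominates n.+1%:R H1.
  exists N; apply: lt_le_trans hN; apply: (@lt_le_trans _ _ n.+1%:R).
    by rewrite ltr_nat.
  by rewrite ler_peMr// ler1n.
have [k kk0 [hk hkS]] : exists2 k, (k0 <= k)%N & H ^+ k <= n%:R /\ n%:R < H ^+ k.+1.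
  elim: j hj => [|j IH] hj.
    by move: hj; rewrite ltNge; case/negP; apply: le_trans nH; rewrite ler_weXn2l// ltW.
  have [/IH//|nj] := ltrP n%:R (H ^+ j).
  exists j => //; rewrite leqNgt; apply/negP => jk0.
  have : H ^+ j.+1 <= H ^+ k0 by rewrite ler_weXn2l// ltW.
  by move/(lt_le_trans hj)/lt_le_trans => /(_ _ nH); rewrite ltxx.
apply: le_trans (hk1 k _ n hk) _; first exact: leq_trans (leq_maxl k1 k2) kk0.
have hk2' := hk2 k (leq_trans (leq_maxr k1 k2) kk0).
have n0 : 0 < n%:R :> R by apply: lt_le_trans nH; rewrite exprn_gt0.
rewrite lee_fin.
apply: (@le_trans _ _ (h ^+ k.+1)^-1); last first.
  rewrite lef_pV2 ?posrE ?powR_gt0 ?exprn_gt0//.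
  rewrite /h -powR_mulrn ?powR_ge0// powRAC powR_mulrn; last exact: ltW.
  by apply: ge0_ler_powR; rewrite ?nnegrE ?exprn_ge0// ltW.
rewrite ler_pdivrMr ?exprn_gt0// mulrC ler_pdivlMr ?exprn_gt0//.
rewrite exprS mulrA -ler_pdivlMr ?exprn_gt0// -exprVn -exprMn.
have [C20|C20] := lerP (C2 * h) 0.
  by apply: le_trans C20 _; rewrite exprn_ge0// divr_ge0// ltW.
by apply: le_trans hk2'; rewrite ler_peMr ?ler1n// ltW.
Qed.

Section Scales.
Variables (G H Delta c0 : R) (l0 B : nat).
Hypotheses (Delta1 : 1 <= Delta) (G2 : 2 * Delta < G) (GH : G < H) (c0_gt0 : 0 < c0).
Hypothesis l0_gt0 : (0 < l0)%N.

(* At scale [2 ^- k], with [G = 2 ^ g'] and [g'] above the irrationality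
   exponent: the rotation comes back [2 ^- k]-close to every point within
   [scale_return k] steps, a cylinder of [scale_word k] symbols has diameter
   [O(2 ^- k)], and [scale_visits k] visits to [I] are enough for all the
   return trials and most likely to occur before [scale_time k]. *)
Definition scale_return k := (Num.truncn (G ^+ k.+1 / c0)).+1.
Definition scale_word k := (l0 * k.+1)%N.
Definition scale_visits k :=
  (scale_return k + scale_return k * scale_word k + scale_word k)%N.
Definition scale_time k := (B * scale_visits k)%N.

Let G0 : 0 < G.
Proof. by have := Delta1; have := G2; lra. Qed.

Let Gk k : 0 < G ^+ k.+1 / c0.
Proof. by rewrite divr_gt0 ?exprn_gt0. Qed.

Lemma scale_return_gt k : G ^+ k.+1 / c0 < (scale_return k)%:R.
Proof. exact: truncnS_gt. Qed.

(** There are about [(G / 2) ^ k] trials, each successful with probability at least [Delta ^ - k].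
    As [2 * Delta < G], which is [d' + 1 < g'] in exponential form, the expected number of successes
    eventually exceeds [k]. *)
Lemma scale_hits : \forall k \near \oo,
  (1 - Delta ^- k) ^+ (scale_return k %/ 2 ^ k) <= 2 ^- k.
Proof.
have D0 : 0 < Delta by exact: lt_le_trans Delta1.
have rho1 : 1 < G / (2 * Delta) by rewrite ltr_pdivlMr ?mul1r ?mulr_gt0.
have [k1 _ hk1] := expr_dominates (c0 / G) rho1.
exists k1 => // k /hk1 hk; apply: expr_onem_le.
  apply/andP; split; first by rewrite invr_ge0 exprn_ge0// ltW.
  by rewrite invf_le1 ?exprn_gt0// exprn_ege1.
set Q := scale_return k; set K := (Q %/ 2 ^ k)%N.
have QK : (Q%:R : R) <= 2 ^+ k * K.+1%:R.
  have : (Q <= 2 ^ k * K.+1)%N by rewrite mulnC ltnW// ltn_ceil// expn_gt0.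
  by rewrite -(ler_nat R) natrM natrX.
have h1 : G ^+ k.+1 / c0 <= 2 ^+ k * K.+1%:R.
  by apply: le_trans QK; apply: ltW; exact: scale_return_gt.
have h2 : k.+1%:R <= Delta ^- k * K.+1%:R.
  rewrite mulrC ler_pdivlMr ?exprn_gt0//.
  have hk' : k.+1%:R * (2 * Delta) ^+ k <= G / c0 * G ^+ k.
    have G0' := G0; move: hk; rewrite expr_div_n ler_pdivlMr ?exprn_gt0 ?mulr_gt0// => hk.
    rewrite (_ : _ * _ = G / c0 * (c0 / G * k.+1%:R * (2 * Delta) ^+ k)).
      by apply: ler_wpM2l => //; rewrite divr_ge0// ltW.
    by field; rewrite !gt_eqF.
  have t0 : 0 < 2 ^+ k :> R by rewrite exprn_gt0.
  rewrite -(ler_pM2r t0) -mulrA -exprMn [Delta * 2]mulrC; apply: le_trans hk' _.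
  by rewrite mulrC [leRHS]mulrC mulrA -exprSr.
have h3 : Delta ^- k <= 1 by rewrite invf_le1 ?exprn_gt0// exprn_ege1.
by move: h2; rewrite -!natr1 mulrDr mulr1; lra.
Qed.

(** Allowing [B] symbols per visit, [wt ^ B <= 1 / 4] outweighs the factor 2 per visit of the Markov
    bound; moreover [scale_visits k >= k]. *)
Lemma scale_count (wt : R) k : 0 <= wt -> wt ^+ B <= 4^-1 ->
  2 ^+ scale_visits k * wt ^+ scale_time k <= 2 ^- k.
Proof.
move=> wt0 wtB; rewrite /scale_time exprM; set Y := scale_visits k.
apply: (@le_trans _ _ (2 ^+ Y * 4^-1 ^+ Y)).
  apply: ler_wpM2l; first exact: exprn_ge0.
  by apply: lerXn2r; rewrite ?nnegrE ?exprn_ge0.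
rewrite -exprMn (_ : 2 / 4 = 2^-1 :> R); last by field.
rewrite -exprVn; apply: ler_wiXn2l; rewrite ?invr_ge0 ?invf_le1 ?ler1n//.
rewrite /Y /scale_visits /scale_word.
apply: leq_trans (leq_addl _ _); apply: leq_trans (leqnSn k) _.
by rewrite leq_pmull.
Qed.

(** The time is of order [k * G ^ k], and any [H > G] absorbs the factor [k] and the constants. *)
Lemma scale_time_le : \forall k \near \oo, (scale_time k).+1%:R <= H ^+ k.
Proof.
have G1 : 1 < G by have := Delta1; have := G2; lra.
have rho1 : 1 < H / G by rewrite ltr_pdivlMr ?mul1r.
(* Each of the three terms of [scale_visits k] is at most the return time multiplied by the word
   length; the 1 pays for the successor. *)
pose C := (3 * B + 1)%:R * l0%:R * (G / c0 + 1).
have [k1 _ hk1] := expr_dominates C rho1.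
exists k1 => // k /hk1; rewrite expr_div_n ler_pdivlMr ?exprn_gt0// => hk.
apply: le_trans hk.
set Q := scale_return k; set l := scale_word k.
have Q0 : (0 < Q)%N by [].
have l1 : (0 < l)%N by rewrite muln_gt0 l0_gt0.
have h1 : ((scale_time k).+1 <= (3 * B + 1) * (Q * l))%N.
  rewrite /scale_time /scale_visits -/Q -/l.
  have a1 : (Q <= Q * l)%N by rewrite leq_pmulr.
  have a2 : (l <= Q * l)%N by rewrite leq_pmull.
  have a3 : (0 < Q * l)%N by rewrite muln_gt0 Q0.
  have : (B * (Q + Q * l + l) <= B * (3 * (Q * l)))%N by rewrite leq_mul2l; lia.
  by rewrite mulnDl mul1n [(3 * B)%N]mulnC -mulnA; lia.
have h2 : (Q%:R : R) <= (G / c0 + 1) * G ^+ k.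
  have h3 : (Num.truncn (G ^+ k.+1 / c0))%:R <= G ^+ k.+1 / c0.
    by rewrite truncn_le// ltW.
  have h4 : 1 <= G ^+ k by rewrite exprn_ege1// ltW.
  rewrite /Q /scale_return -natr1 mulrDl mul1r lerD//.
  by apply: le_trans h3 _; rewrite exprS mulrAC.
apply: (@le_trans _ _ ((3 * B + 1) * (Q * l))%:R); first by rewrite ler_nat.
rewrite natrM /C -!mulrA; apply: ler_wpM2l => //.
rewrite natrM /l /scale_word natrM mulrC -!mulrA; apply: ler_wpM2l => //.
by rewrite mulrCA; apply: ler_wpM2l => //; rewrite mulrC.
Qed.

End Scales.

End Numerics.

Lemma powR_exprn (R : realType) (b g : R) (k : nat) : 0 <= b ->
  (b ^+ k) `^ g = (b `^ g) ^+ k.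
Proof.
by move=> b0; rewrite -(powR_mulrn _ b0) -(powR_mulrn _ (powR_ge0 b g)) powRAC.
Qed.

(** This is the hypothesis of [dense_orbit] for [D = 2 ^ k]: there [q < 2 ^ (k + 1)], which explains
    the exponent [k.+1] in [scale_return]. *)
Lemma scale_return_dist_int (R : realType) (alpha g c : R) (k q : nat) :
  0 <= g -> 0 < c ->
  (forall q : nat, (0 < q)%N -> c <= q%:R `^ g * dist_int (q%:R * alpha)) ->
  (0 < q < 2 * 2 ^ k)%N ->
  (scale_return (2 `^ g) c k)%:R^-1 <= dist_int (q%:R * alpha).
Proof.
move=> g0 c0 hc /andP[q0 qk]; have := scale_return_gt (2 `^ g) c k.
rewrite ltr_pdivrMr//; set Q := scale_return _ _ _ => hQ.
have QR : 0 < Q%:R :> R by rewrite ltr0n.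
rewrite -[leLHS]mul1r ler_pdivrMr//.
have hq : (q%:R : R) `^ g <= (2 `^ g) ^+ k.+1.
  rewrite -powR_exprn// -natrX; have q2 : (q <= 2 ^ k.+1)%N by rewrite expnS ltnW.
  by apply: ge0_ler_powR; rewrite ?nnegrE ?ler0n ?ler_nat.
have h1 : c <= (2 `^ g) ^+ k.+1 * dist_int (q%:R * alpha).
  apply: le_trans (hc q q0) _; apply: ler_wpM2r => //; exact: dist_int_ge0.
rewrite -(ler_pM2r c0) mul1r; apply: le_trans h1 _.
rewrite -mulrA mulrC; apply: ler_wpM2l; first exact: dist_int_ge0.
exact: ltW.
Qed.

(** * Lower bound for the lower limit *)

Section LowerHalf.
Context {R : realType} {Om : pmetricType R} {p : nat}.
Variables (J : 'I_p -> set Om) (T : Om -> Om) (mu : probability (borel Om) R).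
Hypothesis Jcover : forall w, exists i, J i w.
Hypothesis Jclosed : forall i, closed (J i).
Hypothesis Tinv : invariant_measure mu T.
Hypothesis bern : bernoulli_measure J T mu.
Variable pi : (nat -> 'I_p) -> Om.
Hypothesis Hpi : semi_conjugacy J T pi.
Variables (A : set 'I_p) (alpha : R).

Local Notation word := (word T Jcover).
Local Notation generic := (generic J T).
Local Notation weight := (fun i => fine (mu (J i))).
Local Notation near := (near_words T Jcover).
Local Notation lam := (circle_measure R).
Local Notation nu := (product_prob mu lam).
Local Notation X := (borel Om * measurableTypeR R)%type.
Local Notation I := (\bigcup_(i in A) J i).
Local Notation S := (skew_product T (\1_I : Om -> R) alpha).

Lemma ae_fst_fst (P : Om -> Prop) : {ae mu, forall w, P w} ->
  {ae (nu \x nu)%E, forall xy, P xy.1.1}.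
Proof. by move=> /(negligible_fst lam) /(@negligible_fst _ _ _ _ _ nu nu). Qed.

Lemma ae_snd_fst (P : Om -> Prop) : {ae mu, forall w, P w} ->
  {ae (nu \x nu)%E, forall xy, P xy.2.1}.
Proof. by move=> /(negligible_fst lam) /(@negligible_snd _ _ _ _ _ nu nu). Qed.

Lemma near_words_mdist (C theta : R) l r w w' :
  (forall l w w', generic w -> generic w' -> word l w = word l w' ->
    mdist w w' <= C * theta ^+ l) ->
  generic w -> generic w' -> near l r (word l w) (word l w') ->
  mdist w w' <= 2 * (C * theta ^+ l) + r.
Proof.
move=> hC gw gw' /asboolP[z [z' [gz gz' zw zw' zz']]].
have h1 := hC l w z gw gz (esym zw); have h2 := hC l z' w' gz' gw' zw'.
have := metric_triangle w z w'; have := metric_triangle z z' w'; lra.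
Qed.

(** Only pairs of times [(0, i)] are tried: the target has made no visit yet, and the moving orbit
    alone supplies the rotation. *)
Lemma shortest_distance_hit (C theta : R) l n r e k0 (x y : X) :
  (forall l w w', generic w -> generic w' -> word l w = word l w' ->
    mdist w w' <= C * theta ^+ l) ->
  generic x.1 -> generic y.1 -> k0 <= prob weight l (near l r (word l x.1)) ->
  ~ missed T mu Jcover A alpha l n r e k0 (x, y) ->
  forall m, (n < m)%N -> (shortest_distance S m x y <=
    (Num.max (2 * (C * theta ^+ l) + r) e)%:E)%E.
Proof.
move=> hC gx gy kx nmiss m nm.
have [i [iln near_i de]] : exists i, [/\ (i + l <= n)%N,
    near l r (word l x.1) (word l (iter i T y.1)) &
    dist_int ((y.2 : R) - x.2 + (count (fun i => `[< A i >]) (word i y.1))%:R * alpha) < e].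
  apply: contrapT => h; apply: nmiss; split => // i iln near_i.
  by rewrite leNgt; apply/negP => de; apply: h; exists i.
have i_m : (i < m)%N by apply: leq_ltn_trans nm; apply: leq_trans iln; exact: leq_addr.
have m0 : (0 < m)%N by exact: leq_ltn_trans i_m.
apply: le_trans (shortest_distance_le T I alpha x y m0 i_m) _.
rewrite lee_fin dist_M_skew ge_max !le_max; apply/andP; split; apply/orP.
  by left; apply: (near_words_mdist hC) => //; exact: generic_iter.
right; rewrite -dist_intN; apply: le_trans (ltW de).
rewrite le_eqVlt; apply/orP; left; apply/eqP; congr dist_int.
rewrite {1}/visits big_ord0 (visits_word Jcover A i gy) sub0r intrN -pmulrn; ring.
Qed.

Lemma exists_expr_le (t e : R) : 0 <= t < 1 -> 0 < e -> exists2 n, (0 < n)%N & t ^+ n <= e.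
Proof.
move=> /andP[t0 t1] e0.
have /cvgrPdist_lt/(_ e e0)[N _ hN] : t ^+ n @[n --> \oo] --> (0 : R).
  by apply: cvg_expr; rewrite ger0_norm.
exists N.+1 => //; have := hN N.+1 (leqnSn N).
by rewrite sub0r normrN ger0_norm ?exprn_ge0// => /ltW.
Qed.

(** The margin [d_mu < d'] absorbs the error in the mass of balls, [g'] that in the Diophantine
    bound, and [g' < g''] the factor [k] in the running time. Then [g'' * c < 1] turns distance
    [O(2 ^ - k)] at time [2 ^ (g'' * k)] into [n ^ - c]. *)
Lemma liminf_shortest_distance_ge (d_mu d' g' g'' c : R) :
  A !=set0 -> irrational alpha -> pointwise_dimension mu d_mu ->
  d_mu < d' -> 0 <= d' -> (irrationality_exponent alpha < g'%:E)%E ->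
  d' + 1 < g' -> g' < g'' -> 0 < c -> g'' * c < 1 ->
  {ae (nu \x nu)%E, forall xy, (c%:E <= limn_einf (fun k : nat =>
      lne (shortest_distance S k xy.1 xy.2) / (- ln k%:R)%:E))%E}.
Proof.
move=> [a0 Aa0] ia hdim dd' d'0 hg' d'g' g'g'' c0 gc.
have [k0 k00 hk0] := irrationality_exponent_lt ia hg'.
have [C [theta [th C0 hC]]] := generic_word_dist Jcover Jclosed Hpi.
have [l0 l00 hl0] : exists2 n, (0 < n)%N & theta ^+ n <= 2^-1.
  by apply: exists_expr_le; rewrite ?invr_gt0//; case/andP: th => /ltW ->.
pose wt := 1 - (\sum_(i | `[< A i >]) weight i) / 2.
have [w0 w1 _] := bern.
(* [A] is nonempty and its weights are positive, so visits to [I] have positive frequency. *)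
have wt01 : 0 <= wt < 1.
  have s1 : \sum_(i | `[< A i >]) weight i <= 1.
    by rewrite -w1 [leRHS](bigID (fun i => `[< A i >]))/= lerDl sumr_ge0// => i _; exact: ltW.
  have s0 : 0 < \sum_(i | `[< A i >]) weight i.
    rewrite (bigD1 a0)/=; last exact/asboolP.
    by rewrite ltr_pwDl ?w0// sumr_ge0// => i _; exact: ltW.
  by rewrite /wt; apply/andP; split; lra.
have [B _ hB] : exists2 n, (0 < n)%N & wt ^+ n <= 4^-1.
  by apply: exists_expr_le => //; rewrite invr_gt0.
pose G : R := 2 `^ g'; pose H : R := 2 `^ g''; pose Delta : R := 2 `^ d'.
have two1 : 1 <= 2 :> R by rewrite ler1n.
have powR_lt (u v : R) : u < v -> 2 `^ u < 2 `^ v :> R.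
  by move=> uv; rewrite -ltr_ln ?posrE ?powR_gt0// !ln_powR ltr_pM2r// ln_gt0// ltr1n.
have Delta1 : 1 <= Delta by rewrite -(powRr0 2); apply: ler_powR.
have G2 : 2 * Delta < G.
  rewrite -{1}(powRr1 (ler0n R 2)) -powRD; last by apply/implyP => _; rewrite pnatr_eq0.
  by apply: powR_lt; rewrite addrC.
have GH : G < H by exact: powR_lt.
pose l := scale_word l0; pose n := scale_time G k0 l0 B.
(* [many_returns] gives circle distances at most [2 / 2 ^ k]; the 3 makes the bound strict. *)
pose E k := missed T mu Jcover A alpha (l k) (n k) (2 ^- k) (3 / 2 ^+ k) (Delta ^- k).
have BC : {ae (nu \x nu)%E, forall xy, \forall k \near \oo, ~ E k xy}.
  (* Failed trials and too few visits contribute [2 ^ - k] each, hence the constant 2. *)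
  apply: (@borel_cantelli_geometric _ _ _ (nu \x nu)%E E 2) => //.
    by move=> k; exact: (measurable_missed Jcover Jclosed Tinv bern).
  have [k1 _ hk1] := scale_hits Delta1 G2 k00.
  exists k1 => // k /hk1 h1.
  have l_gt0 : (0 < l k)%N by rewrite muln_gt0 l00.
  have D01 : 0 <= Delta ^- k <= 1.
    have Delta0 : 0 < Delta by exact: lt_le_trans Delta1.
    apply/andP; split; first by rewrite invr_ge0 exprn_ge0// ltW.
    by rewrite invf_le1 ?exprn_gt0// exprn_ege1.
  have hms (s : R) : exists ms : seq nat,
    [/\ gapped (l k) ms, {in ms, forall m, m + l k <= scale_visits G k0 l0 k}%N,
        {in ms, forall m, dist_int (s + m%:R * alpha) < 3 / 2 ^+ k}
      & (scale_return G k0 k %/ 2 ^ k <= size ms)%N].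
    set Q := scale_return G k0 k.
    have hQ q : (0 < q < 2 * 2 ^ k)%N -> Q%:R^-1 <= dist_int (q%:R * alpha).
      by apply: scale_return_dist_int => //; apply: le_trans (ltW d'g'); rewrite addr_ge0.
    have pk : (0 < 2 ^ k)%N by rewrite expn_gt0.
    have [ms [g1 g2 g3 g4]] := many_returns (l k) Q s hQ (ltn0Sn _) pk.
    exists ms; split => //.
    - by move=> m /g2 hm; rewrite /scale_visits leq_add2r ltnW.
    - move=> m /g3 hm; apply: le_lt_trans hm _; rewrite natrX.
      by rewrite ltr_pM2r ?invr_gt0 ?exprn_gt0// ltr_nat.
    - by rewrite -(mulKn (size ms) pk) leq_div2r.
  have h := measure_missed_le Jcover Jclosed Tinv bern A (n k) (2 ^- k) l_gt0 D01 hms.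
  apply: le_trans h _.
  rewrite lee_fin mulrDl mul1r; apply: lerD => //.
  by case/andP: wt01 => wt0 _; exact: scale_count.
have hgen : {ae mu, forall w, generic w}.
  exact: (generic_null Jcover Jclosed Tinv bern).
have hgd : {ae mu, forall w, generic w /\
    ln (fine (mu [set v | mdist w v < r])) / ln r @[r --> 0^'+] --> d_mu}.
  exact: ae_and hgen hdim.
apply: ae_imply (ae_and BC (ae_and (ae_fst_fst hgd) (ae_snd_fst hgen))).
move=> -[x y] /= [hE [[gx dx] gy]].
have mpos r : 0 < r -> 0 < fine (mu [set v | mdist x.1 v < r]).
  exact: (measure_mball_gt0 Jcover Jclosed Tinv bern Hpi).
have hball := near_right_pow2 (eventually_measure_mball_ge mpos dd' dx).
have H1 : 1 < H by have := Delta1; have := GH; have := G2; lra.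
have Hc : H `^ c < 2.
  by rewrite -powRrM -[ltRHS](powRr1 (ler0n R 2)); exact: powR_lt.
have hM : \forall m \near \oo, (shortest_distance S m x y <= ((m%:R `^ c)^-1)%:E)%E.
  (* Two cylinder diameters give [2 * C]; the 3 covers both the radius [2 ^ - k] and the circle
     tolerance. *)
  apply: (eventually_power_bound (C2 := 2 * C + 3) H1 c0 Hc).
  have [k1 _ h1] := hE; have [k2 _ h2] := hball.
  have [k3 _ h3] := scale_time_le B Delta1 G2 GH k00 l00.
  exists (maxn k1 (maxn k2 k3)) => // k; rewrite /= !geq_max => /and3P[kk1 kk2 kk3] m Hm.
  have kx : Delta ^- k <= prob weight (l k) (near (l k) (2 ^- k) (word (l k) x.1)).
    apply: le_trans (measure_mball_le Jcover Jclosed Tinv bern (l k) (2 ^- k) gx).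
    have Delta_inv : (2^-1 : R) `^ d' = Delta^-1.
      by rewrite -[2^-1]powR_inv1// -powRrM mulN1r powRN.
    by apply: le_trans (h2 k kk2); rewrite -exprVn powR_exprn ?invr_ge0// Delta_inv exprVn.
  have nm : (n k < m)%N by rewrite -(ler_nat R); apply: le_trans (h3 k kk3) Hm.
  apply: le_trans (shortest_distance_hit hC gx gy kx (h1 k kk1) nm) _.
  rewrite lee_fin.
  have p0 : 0 < 2 ^- k :> R by rewrite invr_gt0 exprn_gt0.
  have th0 : theta ^+ l k <= 2 ^- k.
    have /andP[t0 t1] := th.
    rewrite /l /scale_word exprM -exprVn.
    apply: (@le_trans _ _ (2^-1 ^+ k.+1)).
      by apply: lerXn2r => //; rewrite nnegrE ?invr_ge0 ?exprn_ge0// ltW.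
    by apply: ler_wiXn2l; rewrite ?invr_ge0 ?invf_le1 ?ler1n.
  have h4 : C * theta ^+ l k <= C * 2 ^- k by apply: ler_wpM2l.
  have h5 : 0 <= C * 2 ^- k by rewrite mulr_ge0// ltW.
  by rewrite ge_max mulrDl; apply/andP; split; lra.
apply: limn_einf_ge; have [N _ hN] := hM.
exists (maxn 2 N) => // m; rewrite /= geq_max => /andP[m2 Nm].
apply: log_ratio_ge => //; last exact: hN.
apply: shortest_distance_ge => i j _ _.
by rewrite dist_M_skew le_max dist_int_ge0 orbT.
Qed.

End LowerHalf.

(** * Bounds for the correlation dimension of [nu] *)

Section CorrelationBounds.
Context {R : realType} {Om : pmetricType R}.
Variables (mu : probability (borel Om) R).
Local Notation lam := (circle_measure R).
Local Notation nu := (product_prob mu lam).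
Local Notation X := (borel Om * measurableTypeR R)%type.

(* The integrands below are not known to be measurable; their integral is
   then a lower integral, which is still monotone. *)
Lemma le_lower_integral d (Y : measurableType d) (m : {measure set Y -> \bar R})
    (f g : Y -> \bar R) : (forall x, 0 <= f x)%E -> (forall x, f x <= g x)%E ->
  (\int[m]_x f x <= \int[m]_x g x)%E.
Proof.
move=> f0 fg; rewrite !ge0_integralTE//; last by move=> x; exact: le_trans (fg x).
apply: ge_ereal_sup => _ [h /= hf <-]; apply: ereal_sup_ubound.
by exists h => //= x; exact: le_trans (hf x) (fg x).
Qed.

Lemma measurable_dist_M_ball (x : X) (r : R) : measurable [set y | dist_M x y < r].
Proof.
rewrite (_ : [set y | _] = [set w | mdist (x.1 : Om) w < r] `*`
    [set t | dist_int (1 * t + - (x.2 : R)) < r]).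
  apply: measurableX; [exact: measurable_mball|exact: measurable_strip].
apply/seteqP; split => -[w t] /=; rewrite /dist_M /= gt_max mul1r -dist_intN opprB.
  by move=> /andP[].
by move=> [-> ->].
Qed.

Lemma dist_M_ballX (x : X) (r : R) : [set y | dist_M x y < r] =
  [set w | mdist (x.1 : Om) w < r] `*` [set t | dist_int ((x.2 : R) - t) < r].
Proof.
apply/seteqP; split => -[w t] /=; rewrite /dist_M /= gt_max.
  by move=> /andP[].
by move=> [-> ->].
Qed.

(** The circle factor alone gives this bound, enough to make the correlation dimension positive. *)
Lemma correlation_le r : 0 < r ->
  ((\int[nu]_x nu [set y | (dist_M x y < r)%R]) <= (8 * r)%:E)%E.
Proof.
move=> r0; apply: (@le_trans _ _ (\int[nu]_x (8 * r)%:E)%E).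
  apply: le_lower_integral => // x.
  apply: (@le_trans _ _ (nu (setT `*` [set t | dist_int (1 * t + - (x.2 : R)) < r]))).
    apply: le_measure; rewrite ?inE; first exact: measurable_dist_M_ball.
      by apply: measurableX => //; exact: measurable_strip.
    by rewrite dist_M_ballX => -[w t] /= [_ h]; split => //; rewrite mul1r -dist_intN opprB.
  rewrite product_probX//; last exact: measurable_strip.
  by rewrite probability_setT mul1e (@circle_measure_strip R 1).
by rewrite integral_cst//= probability_setT mule1.
Qed.

(** The integral is at least the squared mass of the ball of radius [r] about [(w, 0)]. *)
Lemma correlation_ge (w : Om) r : 0 < r <= 2^-1 ->
  (((fine (mu [set v | mdist w v < r]) * r) ^+ 2)%:E <=
    \int[nu]_x nu [set y | (dist_M x y < 2 * r)%R])%E.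
Proof.
move=> r01; have r0 : 0 < r by case/andP: r01.
pose x0 : X := (w, 0 : R); pose B := [set y | dist_M x0 y < r].
have mB : measurable B by exact: measurable_dist_M_ball.
have nuB : ((fine (mu [set v | mdist w v < r]) * r)%:E <= nu B)%E.
  rewrite /B dist_M_ballX product_probX/=; first last.
  - rewrite (_ : mkset _ = [set t | dist_int (1 * t + 0) < r]).
      exact: measurable_strip.
    by apply/seteqP; split => t /=; rewrite mul1r sub0r dist_intN addr0.
  - exact: measurable_mball.
  rewrite EFinM fineK ?fin_num_measure//; last exact: measurable_mball.
  by apply: lee_wpmul2l => //; apply: circle_measure_ball_ge => //; rewrite lexx ler01.
have c0 : 0 <= fine (mu [set v | mdist w v < r]) * r.
  by rewrite mulr_ge0 ?fine_ge0// ltW.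
apply: (@le_trans _ _ (\int[nu]_x ((nu B) * (\1_B x)%:E))%E); last first.
  apply: le_lower_integral => x; first by rewrite mule_ge0.
  rewrite indicE; have [xB|xB] := boolP (x \in B); last first.
    by apply: (@le_trans _ _ 0%E); [rewrite mule0|exact: measure_ge0].
  rewrite mule1; apply: le_measure; rewrite ?inE//; first exact: measurable_dist_M_ball.
  rewrite inE in xB => y /= By; rewrite /dist_M gt_max.
  move: xB By; rewrite /B /= /dist_M !gt_max => /andP[x1 x2] /andP[y1 y2].
  apply/andP; split.
    apply: le_lt_trans (metric_triangle _ w _) _; rewrite metric_sym.
    by rewrite mulrDl mul1r ltrD.
  rewrite (_ : (x.2 : R) - y.2 = - (x0.2 - (x.2 : R)) + (x0.2 - (y.2 : R))); last by ring.
  apply: le_lt_trans (dist_intD _ _) _; rewrite dist_intN.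
  by rewrite mulrDl mul1r ltrD.
rewrite ge0_integralZl//; last exact/measurable_EFinP/measurable_indic.
rewrite integral_indic// setIT expr2 EFinM.
by apply: lee_pmul.
Qed.

Variables (w : Om) (d : R).
Hypothesis mpos : forall r, 0 < r -> 0 < fine (mu [set v | mdist w v < r]).
Hypothesis hd :
  ln (fine (mu [set v | mdist w v < r])) / ln r @[r --> 0^'+] --> d.

Lemma pointwise_dimension_ge0 : 0 <= d.
Proof.
rewrite leNgt; apply/negP => d0.
have : \forall r \near 0^'+, 0 <= ln (fine (mu [set v | mdist w v < r])) / ln r.
  near=> r.
  have r0 : 0 < r by near: r; exact: nbhs_right_gt.
  have r1 : r < 1 by near: r; exact: nbhs_right_lt.
  have lr : ln r < 0 by apply: ln_lt0; rewrite r0 r1.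
  rewrite ler_ndivlMr// mul0r; apply: ln_le0.
  rewrite -lee_fin fineK ?fin_num_measure//; last exact: measurable_mball.
  exact: probability_le1 (measurable_mball w r).
move=> /near_right_pow2[N1 _ h1].
move/cvgrPdist_lt : hd => /(_ (- d)); rewrite oppr_gt0 => /(_ d0).
move=> /near_right_pow2[N2 _ h2].
have := h1 (maxn N1 N2) (leq_maxl _ _); have := h2 (maxn N1 N2) (leq_maxr _ _).
by rewrite ltr_norml => /andP[h _]; lra.
Unshelve. all: by end_near. Qed.

(* The upper bound [2 * (d + 1)] comes from a single ball of radius [r], whose
   points are at distance less than [2 * r] of each other. *)
Lemma correlation_dimension_bounds (C : R) :
  correlation_dimension (@dist_M R Om) (mu \x lam)%E C -> 0 < C <= 2 * (d + 1).
Proof.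
have aux1 (x y z : R) : - x < 2^-1 * y -> x <= 3 * z - y -> 7 * z <= y -> 0 < z ->
  False by lra.
have aux2 (x t z y a e : R) : 0 < z -> (a - e / 4) * (t * z) < - x ->
    (y * - ((t + 1) * z) - (t + 1) * z) *+ 2 <= x ->
    2 * (y + 1) = a - 3 / 4 * e -> 0 <= e * t -> 0 < e -> 2 * a < e * t -> False.
  move=> z0 h1; rewrite -mulr_natl => h2 h3 h4 h5 h6.
  have : (a - e / 4) * t * z < 2 * (y + 1) * (t + 1) * z by lra.
  by rewrite ltr_pM2r// h3; lra.
move=> hC; pose F r := fine (\int[nu]_x nu [set y | (dist_M x y < r)%R])%E.
have {}hC : ln (F r) / ln r @[r --> 0^'+] --> C by exact: hC.
have F0 x r : (0 <= nu [set y | (dist_M x y < r)%R])%E by [].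
have Ffin r : 0 < r ->
    (\int[nu]_x nu [set y | (dist_M x y < r)%R])%E = (F r)%:E.
  move=> r0; rewrite /F fineK// ge0_fin_numE; last exact: integral_ge0.
  by apply: le_lt_trans (correlation_le r0) _; exact: ltry.
pose L : R := ln 2; have L0 : 0 < L by rewrite ln_gt0// ltr1n.
have lnpow k : ln (2 ^- k : R) = - (k%:R * L).
  by rewrite lnV ?posrE ?exprn_gt0// lnXn// mulr_natl.
have pow0 k : 0 < 2 ^- k :> R by rewrite invr_gt0 exprn_gt0.
have twoS k : 2 * 2 ^- k.+1 = 2 ^- k :> R.
  by rewrite exprS invfM mulrA divff// mul1r.
have Fge k : (fine (mu [set v | mdist w v < 2 ^- k.+1]) * 2 ^- k.+1) ^+ 2 <= F (2 ^- k).
  have r01 : 0 < (2 ^- k.+1 : R) <= 2^-1.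
    rewrite pow0/= lef_pV2 ?posrE ?exprn_gt0// exprS ler_peMr// exprn_ege1//.
    by rewrite ler1n.
  by have := correlation_ge w r01; rewrite twoS (Ffin _ (pow0 k)) lee_fin.
have Fpos k : 0 < F (2 ^- k).
  by apply: lt_le_trans (Fge k); rewrite exprn_gt0// mulr_gt0// mpos.
have ratio k : (0 < k)%N -> ln (F (2 ^- k)) / ln (2 ^- k : R) = - ln (F (2 ^- k)) / (k%:R * L).
  by move=> k0; rewrite lnpow invrN mulrN mulNr.
apply/andP; split; [rewrite ltNge|rewrite leNgt]; apply/negP => hC0.
  move/cvgrPdist_lt : hC => /(_ 2^-1); rewrite invr_gt0 => /(_ (ltr0n R 2)).
  (* [F (2 ^- k) <= 8 * 2 ^- k] makes the ratio at least [(k - 3) / k], above [1 / 2] for [k >= 7],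
     against a limit that is at most 0. *)
  move=> /near_right_pow2[N _ hN]; pose k := maxn N 7.
  have k0 : (0 < k)%N by rewrite leq_max orbT.
  have kR : 7 <= k%:R :> R by rewrite ler_nat leq_maxr.
  have := hN k (leq_maxl _ _); rewrite ratio// ltr_norml => /andP[h _].
  have : - ln (F (2 ^- k)) / (k%:R * L) < 2^-1 by lra.
  have kL : 0 < k%:R * L by rewrite mulr_gt0// ltr0n.
  rewrite ltr_pdivrMr// => h1.
  have : ln (F (2 ^- k)) <= ln (8 * 2 ^- k).
    rewrite ler_ln ?posrE ?mulr_gt0//.
    by have := correlation_le (pow0 k); rewrite (Ffin _ (pow0 k)) lee_fin.
  rewrite lnM ?posrE// lnpow (_ : 8 = 2 ^+ 3 :> R); last by rewrite -natrX.
  rewrite lnXn// -/L -(mulr_natl L 3) => h2.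
  have h3 : 7 * L <= k%:R * L by apply: ler_wpM2r => //; exact: ltW.
  exact: aux1 h1 h2 h3 L0.
(* The choice of [d'] gives [2 * (d' + 1) = C - 3 / 4 * delta], while the ratio exceeds
   [C - delta / 4]. The excess [delta / 2 * k] beats the loss, at most [C], from halving the radius
   once [delta * k > 2 * C]. *)
pose delta := C - 2 * (d + 1); pose d' := d + delta / 8.
have delta0 : 0 < delta by rewrite subr_gt0.
have dd' : d < d' by rewrite ltrDl divr_gt0.
have [N1 _ h1] := near_right_pow2 (eventually_measure_mball_ge mpos dd' hd).
have delta4 : 0 < delta / 4 by rewrite divr_gt0.
move/cvgrPdist_lt : hC => /(_ _ delta4) /near_right_pow2[N2 _ h2].
pose N3 := (Num.truncn (2 * C / delta)).+1.
pose k := maxn 1 (maxn N1 (maxn N2 N3)).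
have k0 : (0 < k)%N by rewrite leq_max.
have k1 : (N1 <= k.+1)%N by apply: leqW; rewrite !leq_max leqnn !orbT.
have k2 : (N2 <= k)%N by rewrite !leq_max leqnn !orbT.
have k3 : (N3 <= k)%N by rewrite !leq_max leqnn !orbT.
have kR : 0 < k%:R :> R by rewrite ltr0n.
have kC : 2 * C < delta * k%:R.
  rewrite -ltr_pdivrMl// mulrC; apply: lt_le_trans (truncnS_gt _) _.
  by rewrite ler_nat.
have := h2 k k2; rewrite ratio// ltr_norml => /andP[_ h].
have h3 : C - delta / 4 < - ln (F (2 ^- k)) / (k%:R * L).
  by rewrite ltrBlDr addrC -ltrBlDr.
move: h3; rewrite ltr_pdivlMr ?mulr_gt0// => h3.
have pw0 : 0 < (2 ^- k.+1 : R) `^ d' by rewrite powR_gt0.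
have h4 : ((2 ^- k.+1) `^ d' * 2 ^- k.+1) ^+ 2 <= F (2 ^- k).
  apply: le_trans (Fge k); apply: lerXn2r.
  - by rewrite nnegrE mulr_ge0// ltW.
  - by rewrite nnegrE mulr_ge0 ?fine_ge0// ltW.
  by apply: ler_wpM2r; [exact: ltW|exact: h1].
have : ln (((2 ^- k.+1) `^ d' * 2 ^- k.+1) ^+ 2) <= ln (F (2 ^- k)).
  by rewrite ler_ln ?posrE ?exprn_gt0 ?mulr_gt0.
rewrite lnXn ?mulr_gt0// lnM ?posrE// ln_powR lnpow -natr1 => h5.
apply: (aux2 _ _ _ d' C delta L0 h3 h5) => //; first by rewrite /d' /delta; field.
by rewrite mulr_ge0// ltW.
Qed.

End CorrelationBounds.

(** * Almost sure equality and the strict inequality *)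

Section Conclusion.
Context {R : realType} {Om : pmetricType R} {p : nat}.
Variables (J : 'I_p -> set Om) (T : Om -> Om) (mu : probability (borel Om) R).
Hypothesis Jcover : forall w, exists i, J i w.
Hypothesis Jclosed : forall i, closed (J i).
Hypothesis Tinv : invariant_measure mu T.
Hypothesis bern : bernoulli_measure J T mu.
Variable pi : (nat -> 'I_p) -> Om.
Hypothesis Hpi : semi_conjugacy J T pi.
Variables (A : set 'I_p) (alpha d_mu : R).
Hypotheses (A0 : A !=set0) (alpha_irr : irrational alpha).
Hypothesis hd : pointwise_dimension mu d_mu.
Hypothesis d_mu0 : 0 <= d_mu.
Hypothesis hgamma : ((d_mu + 1)%:E < irrationality_exponent alpha)%E.

Local Notation lam := (circle_measure R).
Local Notation nu := (product_prob mu lam).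
Local Notation X := (borel Om * measurableTypeR R)%type.
Local Notation I := (\bigcup_(i in A) J i).
Local Notation S := (skew_product T (\1_I : Om -> R) alpha).
Local Notation loglim x y := (limn_einf (fun k : nat =>
  lne (shortest_distance S k x y) / (- ln k%:R)%:E)%E).

Lemma exists_typical_point : exists w, generic J T w /\
  ln (fine (mu [set v | mdist w v < r])) / ln r @[r --> 0^'+] --> d_mu.
Proof.
have hgd := ae_and (generic_null Jcover Jclosed Tinv bern) hd.
apply: contrapT => h.
have : mu setT = 0%E.
  apply: measure_negligible => //; apply: negligibleS hgd => w _ /= hw.
  by apply: h; exists w.
by rewrite probability_setT => /eqP; rewrite onee_eq0.
Qed.

(** The two starting points already keep the distance bounded. For an infinite exponent, whose
    inverse is 0, this is the entire lower bound. *)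
Lemma loglim_ge_neg (c : R) (x y : X) : c < 0 -> (c%:E <= loglim x y)%E.
Proof.
move=> c0; apply: limn_einf_ge.
have [N _ hN] : \forall q \near \oo, dist_M x y <= (q%:R : R) `^ (- c).
  by apply: nat_powR_ge; rewrite oppr_gt0.
exists (maxn 2 N) => // k; rewrite /= geq_max => /andP[k2 /hN hk].
have k0 : (0 < k)%N by exact: ltnW.
apply: log_ratio_ge => //.
  apply: shortest_distance_ge => i j _ _.
  by rewrite dist_M_skew le_max dist_int_ge0 orbT.
apply: le_trans (shortest_distance_le T I alpha x y k0 k0) _.
by rewrite lee_fin -powRN.
Qed.

Lemma loglim_ge_ae (c : R) : (c%:E < (irrationality_exponent alpha)^-1)%E ->
  {ae (nu \x nu)%E, forall xy, (c%:E <= loglim xy.1 xy.2)%E}.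
Proof.
have [c0 _|c0] := ltrP c 0.
  by apply: ae_imply (aeW _ _) => // xy _; exact: loglim_ge_neg.
case E : (irrationality_exponent alpha) hgamma => [ga| |] // hga; last first.
  by rewrite invey lte_fin ltNge c0.
rewrite lte_fin in hga.
have ga0 : 0 < ga by apply: lt_trans hga; apply: ltr_wpDl.
have giv0 : 0 < ga^-1 by rewrite invr_gt0.
rewrite inver gt_eqF// lte_fin => cga.
(* Midpoints split the strict gaps in [c < 1 / ga] and [d_mu + 1 < ga]; [c'] is positive even when
   [c = 0]. *)
pose c' := (c + ga^-1) / 2.
have c'0 : 0 < c' by rewrite /c'; lra.
have c'ga : c' < ga^-1 by rewrite /c'; lra.
have gac' : ga < c'^-1 by rewrite -[ltLHS]invrK ltf_pV2 ?posrE.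
pose g'' := (ga + c'^-1) / 2; pose g' := (ga + g'') / 2.
pose d' := (d_mu + (ga - 1)) / 2.
have g''c : g'' * c' < 1 by rewrite -ltr_pdivlMr// mul1r /g''; lra.
have gag' : ga < g' /\ g' < g'' by rewrite /g' /g''; split; lra.
have dd' : d_mu < d' by rewrite /d'; lra.
have d'0 : 0 <= d' by exact: le_trans (ltW dd').
have Eg' : (irrationality_exponent alpha < g'%:E)%E by rewrite E lte_fin gag'.1.
have d'g' : d' + 1 < g' by have := gag'.1; rewrite /d'; lra.
apply: ae_imply (liminf_shortest_distance_ge Jcover Jclosed Tinv bern Hpi A0
  alpha_irr hd dd' d'0 Eg' d'g' gag'.2 c'0 g''c).
by move=> xy; apply: le_trans; rewrite lee_fin /c'; lra.
Qed.

(** Any [b] strictly between [1 / c] and the exponent serves: the midpoint, or [2 / c] when the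
    exponent is infinite. *)
Lemma loglim_le_ae (c : R) : ((irrationality_exponent alpha)^-1 < c%:E)%E ->
  {ae (nu \x nu)%E, forall xy, (loglim xy.1 xy.2 <= c%:E)%E}.
Proof.
move=> hc.
have [b [b0 c0 bc hb]] : exists b, [/\ 0 < b, 0 < c, 1 < b * c
    & (b%:E < irrationality_exponent alpha)%E].
  case E : (irrationality_exponent alpha) hgamma hc => [ga| |] // hga; last first.
    rewrite invey lte_fin => c0; exists (2 / c); split => //.
    - by rewrite divr_gt0.
    - by rewrite divfK ?gt_eqF// ltr1n.
    - exact: ltry.
  rewrite lte_fin in hga.
  have ga0 : 0 < ga by apply: lt_trans hga; apply: ltr_wpDl.
  rewrite inver gt_eqF// lte_fin => cga.
  have c0 : 0 < c by apply: lt_trans cga; rewrite invr_gt0.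
  have cga' : c^-1 < ga by rewrite -[ltRHS]invrK ltf_pV2 ?posrE ?invr_gt0.
  have ci0 : 0 < c^-1 by rewrite invr_gt0.
  exists ((ga + c^-1) / 2); split => //.
  - by lra.
  - by rewrite -ltr_pdivrMr// mul1r; lra.
  - by rewrite lte_fin; lra.
exact: (liminf_shortest_distance_le mu T I b0 c0 bc hb).
Qed.

Lemma loglim_eq_ae : {ae (nu \x nu)%E, forall xy,
  loglim xy.1 xy.2 = (irrationality_exponent alpha)^-1%E}.
Proof.
have [g hg] : exists g : R, (irrationality_exponent alpha)^-1%E = g%:E.
  case E : (irrationality_exponent alpha) hgamma => [ga| |] // hga; last first.
    by exists 0; rewrite invey.
  rewrite lte_fin in hga.
  have ga0 : 0 < ga by apply: lt_trans hga; apply: ltr_wpDl.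
  by exists ga^-1; rewrite inver gt_eqF.
have hk (k : nat) : {ae (nu \x nu)%E, forall xy,
    ((g - k.+1%:R^-1)%:E <= loglim xy.1 xy.2)%E /\
    (loglim xy.1 xy.2 <= (g + k.+1%:R^-1)%:E)%E}.
  have e0 : 0 < k.+1%:R^-1 :> R by rewrite invr_gt0.
  apply: ae_and.
    by apply: loglim_ge_ae; rewrite hg lte_fin ltrBlDr ltrDl.
  by apply: loglim_le_ae; rewrite hg lte_fin ltrDl.
apply: negligibleS (negligible_countable hk) => xy /= neq.
apply: contrapT => h; apply: neq; rewrite hg.
have {}h k : ((g - k.+1%:R^-1)%:E <= loglim xy.1 xy.2)%E /\
    (loglim xy.1 xy.2 <= (g + k.+1%:R^-1)%:E)%E.
  by apply: contrapT => hk'; apply: h; exists k.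
have arch (e : R) : 0 < e -> exists k : nat, k.+1%:R^-1 <= e.
  move=> e0; exists (Num.truncn e^-1).
  rewrite -[leRHS]invrK lef_pV2 ?posrE ?invr_gt0//.
  exact: ltW (truncnS_gt _).
apply/eqP; rewrite eq_le; apply/andP; split; apply/lee_addgt0Pr => e e0.
  have [k ke] := arch e e0; apply: le_trans (h k).2 _.
  by rewrite -EFinD lee_fin lerD2l.
have [k ke] := arch e e0; rewrite -leeBlDr//; apply: le_trans (h k).1.
by rewrite -EFinB lee_fin lerD2l lerN2.
Qed.

(** A finite exponent exceeds [d_mu + 1 >= C / 2]; for an infinite one the left side is 0 and
    [0 < C] suffices. *)
Lemma irrationality_exponent_lt_correlation (C : R) : 0 < C <= 2 * (d_mu + 1) ->
  ((irrationality_exponent alpha)^-1 < (2 / C)%:E)%E.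
Proof.
move=> /andP[C0 Cd].
case E : (irrationality_exponent alpha) hgamma => [ga| |] // hga; last first.
  by rewrite invey lte_fin divr_gt0.
rewrite lte_fin in hga.
have ga0 : 0 < ga by apply: lt_trans hga; apply: ltr_wpDl.
rewrite inver gt_eqF// lte_fin ltr_pdivlMr// mulrC ltr_pdivrMr//.
by apply: le_lt_trans Cd _; rewrite ltr_pM2l.
Qed.

End Conclusion.

Theorem theorem5p4
  (R : realType) (n : nat) (Om : pmetricType R)
  (M : riemannian_manifold n Om)
  (p : nat) (J : 'I_p -> set Om) (T : Om -> Om) (beta eta : R)
  (HT : piecewise_expanding_markov M J T beta eta)
  (Hmix : topologically_mixing T)
  (pi : (nat -> 'I_p) -> Om) (Hpi : semi_conjugacy J T pi)
  (mu : probability (borel Om) R) (psi : Om -> R)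
  (Hpsi : piecewise_holder J psi)
  (Hmu : equilibrium_state mu T psi)
  (Hfull : forall i, T @` J i = setT)
  (Hbern : bernoulli_measure J T mu)
  (I : set Om)
  (HI : exists2 A : set 'I_p, A !=set0 & I = \bigcup_(i in A) J i)
  (HNA : cond_NA J T pi (\1_I : Om -> R))
  (alpha : R) (Halpha : irrational alpha)
  (d_mu C_nu : R)
  (Hd_mu : pointwise_dimension mu d_mu)
  (HC_nu : correlation_dimension (@dist_M R Om) (mu \x circle_measure R)%E C_nu)
  (Hgamma : ((d_mu + 1)%:E < irrationality_exponent alpha)%E) :
  let S := skew_product T (\1_I : Om -> R) alpha in
  let nu := (mu \x circle_measure R)%E in
  {ae (nu \x nu)%E, forall xy,
    limn_einf (fun k : nat =>
      lne (shortest_distance S k xy.1 xy.2) / (- ln k%:R)%:E)%E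
    = (irrationality_exponent alpha)^-1%E} /\
  ((irrationality_exponent alpha)^-1 < (2 / C_nu)%:E)%E.
Proof.
have Jcover w : exists i, J i w.
  have : setT w by []; rewrite -(pem_cover HT) => -[i _ Ji]; by exists i.
have Jclosed := pem_closed HT.
have [Tinv _ _] := Hmu.
case: HI => A A0 ->.
have [w [gw dw]] := exists_typical_point Jcover Jclosed Tinv Hbern Hd_mu.
have mpos r : 0 < r -> 0 < fine (mu [set v | mdist w v < r]).
  exact: (measure_mball_gt0 Jcover Jclosed Tinv Hbern Hpi).
have d0 := pointwise_dimension_ge0 dw.
have C0 := correlation_dimension_bounds mpos dw HC_nu.
move=> S nu; split; last first.
  exact: (irrationality_exponent_lt_correlation d0 Hgamma C0).
exact: (loglim_eq_ae Jcover Jclosed Tinv Hbern Hpi A0 Halpha Hd_mu d0 Hgamma).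
Qed.
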